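(* Let $X_1,\dots,X_N$, $Y_1,\dots,Y_{N'}$ and $\alpha$ be as in the standing assumptions of the context, and suppose in addition that $X_1,\dots,X_N$ satisfies conditions (C5), (C6) and (C7) of the context. Let $i$ be an index such that $X_i$ consists of finite configurations, and let $k_0=|K|$ be the number of points of $K\in X_i$. Then for all $K\in X_i=Y_{\alpha(i)}$ one has $\tilde\Lambda(K)=\Lambda(K)$ and $\tilde\partial\Lambda(K)=\partial\Lambda(K)$, and there exists a continuous map $\Phi_{\alpha(i)}\setminus\Phi_{\alpha(i-1)}\to\mathbf M^{*k_0}$ into the $k_0$-th self-join of $\mathbf M$ that takes the point $K\in\Lambda(K)\setminus\partial\Lambda(K)\subset\Phi_{\alpha(i)}\setminus\Phi_{\alpha(i-1)}$ to the barycentre of the simplex $\triangle(K)$ spanned by the points of $K$. This map is a homeomorphism onto its image, and for every $K\in X_i$ it takes $\Lambda(K)$ (respectively $\partial\Lambda(K)$) homeomorphically onto $\triangle(K)$ (respectively $\partial\triangle(K)$), in the sense that its restriction to $\Lambda(K)\setminus\partial\Lambda(K)$ extends to a homeomorphism $\Lambda(K)\to\triangle(K)$ carrying $\partial\Lambda(K)$ onto $\partial\triangle(K)$.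
   Context: Setting. $k=\mathbb R$ or $\mathbb C$; $V$ is a finite-dimensional $k$-vector space; $\mathbf M$ is a finite CW-complex; $\mathcal V\to\mathbf M$ is a $k$-vector bundle; $ev:V\times\mathbf M\to\mathcal V$ is a constant rank map of vector bundles over $\mathbf M$, $ev_x=ev|_{V\times\{x\}}$. For $K\subset\mathbf M$ put $L(K)=\bigcap_{x\in K}\ker ev_x$; for $f\in V$ put $\mathrm{Sing}(f)=\{x\in\mathbf M: f\in\ker ev_x\}$; $\Sigma=\{f\in V:\mathrm{Sing}(f)\ne\varnothing\}$. $2^{\mathbf M}$ is the space of non-empty compact subsets of $\mathbf M$ (''configurations'') with the Hausdorff metric; closures of subsets of $2^{\mathbf M}$ are taken there. Conditions on a sequence $X_1,\dots,X_N\subset2^{\mathbf M}$: (C1) for every $f\in\Sigma$, $\mathrm{Sing}(f)$ belongs to some $X_i$; (C2) if $K\in X_i$, $K'\in X_j$, $K\subsetneq K'$, then $i<j$; (C3) $\dim_kL(K)$ is the same for all $K\in X_i$; (C4) $X_i\cap X_j=\varnothing$ for $i\ne j$; (C5−) for every $K\in\bigcup_i\bar X_i$ there is a smallest element $\mathrm{Geom}(K)$ (the geometrisation of $K$) among the elements of $\bigcup_iX_i$ containing $K$; moreover $L(K)=L(\mathrm{Geom}(K))$, and $\mathrm{Geom}(K)\in\bigcup_{j\le i}X_j$ whenever $K\in\bar X_i\setminus X_i$; (C5) same as (C5−) but with $\mathrm{Geom}(K)\in\bigcup_{j<i}X_j$ whenever $K\in\bar X_i\setminus X_i$; (C5+)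 $\bar X_i\subset\bigcup_{j\le i}X_j$ for every $i$; (C6) put $A_i=\{K\in\bigcup_j\bar X_j: K\subset K'\text{ for some }K'\in\bigcup_{l\le i}X_l\}$, $\mathcal T_i=\{(x,K)\in\mathbf M\times X_i:x\in K\}$, $\mathcal R_i=\{(K,K')\in A_i\times X_i:K\subset K'\}$, $\mathcal S_i=\{(K,K')\in A_{i-1}\times X_i:K\subset K'\}$; for every $i$ these three spaces are locally trivial fibre bundles over $X_i$ via the obvious projections, and local trivialisations of $\mathcal T_i\to X_i$ induce local trivialisations of $\mathcal R_i\to X_i$ and $\mathcal S_i\to X_i$; (C7) if $K\in X_i$ is finite, then every non-empty proper subset $K'\subset K$ belongs to some $X_j$ with $j<i$. Standing assumptions. $X_1,\dots,X_N$ satisfies (C1)–(C4), (C5−). $Y_1,\dots,Y_{N'}\subset 2^{\mathbf M}$ is a sequence satisfying (C1)–(C4), (C5+), and $\alpha:\{1,\dots,N\}\to\{1,\dots,N'\}$ is strictly increasing (put $\alpha(0)=0$) with: $Y_{\alpha(i)}=X_i$; $\bigcup_jY_j=\bigcup_i\bar X_i$; if $\alpha(i-1)<j\le\alpha(i)$ then the geometrisation (with respect to $X_1,\dots,X_N$) of every $K\in Y_j$ belongs to $X_i$. The space $\mathbf Y=\bigcup_jY_j$ is homeomorphic to a finite CW-complex. Construction. For a space $A$, a map of $A$ to a real vector space is $m$-generic if it is injective, every $(m-1)$-simplex with vertices in the image is non-degenerate, and any two such simplices meet in a common face (empty if the vertex sets are disjoint). For compact $A$ the $m$-th self-join $A^{*m}$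 is the union of all $(m-1)$-simplices (and their faces) with vertices in the image of a continuous $m$-generic embedding $A\to\mathbb R^\Omega$; points of $A$ are identified with their images. A simplex of $\mathbf Y^{*N'}$ is coherent if its vertices form a chain with respect to inclusion; its largest vertex is its principal vertex. For $K\in\mathbf Y$, $\tilde\Lambda(K)$ is the union of all coherent simplices with principal vertex $K$; for $K\in Y_i$, $\tilde\partial\Lambda(K)=\bigcup_{j<i}\bigcup_{K'\in Y_j,K'\subset K}\tilde\Lambda(K')$. For $K\in X_i$: $\Lambda(K)$ is the union of all coherent simplices with principal vertex $K$ such that every vertex $K'\ne K$ satisfies $\mathrm{Geom}(K')\ne K$; $\partial\Lambda(K)=\bigcup_{j<i}\bigcup_{K'\in X_j,K'\subset K}\tilde\Lambda(K')$. Put $\Phi_0=\varnothing$, $\Phi_i=\bigcup_{j\le i}\bigcup_{K\in Y_j}\tilde\Lambda(K)$. *)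

(* Defs.v *)
From HB Require Import structures.
From mathcomp Require Import all_boot all_order all_algebra finmap.
From mathcomp Require Import all_classical all_reals all_analysis.
From mathcomp Require Import complex lra.

Set Implicit Arguments.
Unset Strict Implicit.
Unset Printing Implicit Defensive.

Import Order.TTheory GRing.Theory Num.Theory.
Import numFieldNormedType.Exports.

Local Open Scope classical_set_scope.
Local Open Scope ring_scope.

Inductive real_or_complex (R : realType) : numFieldType -> Prop :=
| scalar_real : real_or_complex R R
| scalar_complex : real_or_complex R R[i].

(* [f] restricts to a homeomorphism between the subspaces [A] and [B]; the
   continuity of the inverse is stated as "images of relatively open sets are
   relatively open", which also makes sense when [S] is empty. *)
Definition homeo_on (S T : topologicalType) (A : set S) (B : set T)
    (f : S -> T) : Prop :=
  [/\ {within A, continuous f}, set_bij A B f &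
      forall U : set S, open U ->
        exists2 W : set T, open W & f @` (A `&` U) = B `&` W].

Definition sqnorm (R : realType) (d : nat) (x : 'rV[R]_d) : R :=
  \sum_(j < d) x 0 j ^+ 2.

Definition closed_disk (R : realType) (d : nat) : set 'rV[R]_d :=
  [set x | sqnorm x <= 1].

Definition open_disk (R : realType) (d : nat) : set 'rV[R]_d :=
  [set x | sqnorm x < 1].

Definition unit_sphere (R : realType) (d : nat) : set 'rV[R]_d :=
  [set x | sqnorm x = 1].

Arguments closed_disk : clear implicits.
Arguments open_disk : clear implicits.
Arguments unit_sphere : clear implicits.

(* The subspace [A] carries the structure of a finite CW-complex, with
   characteristic maps [phi].  Subspaces of a metric space are Hausdorff, and
   with finitely many cells the topology is automatically the weak one. *)
Definition finite_CW (R : realType) (T : metricType R) (A : set T) : Prop :=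
  exists (c : nat) (d : 'I_c -> nat) (phi : forall q, 'rV[R]_(d q) -> T),
    let cell q := phi q @` open_disk R (d q) in
    [/\ forall q, {within closed_disk R (d q), continuous (phi q)},
        forall q, set_inj (open_disk R (d q)) (phi q),
        trivIset setT cell,
        \bigcup_q cell q = A &
        forall q, phi q @` unit_sphere R (d q) `<=`
                    \bigcup_(r in [set r | (d r < d q)%N]) cell r].

Record vector_bundle (k : numFieldType) (M : topologicalType) := VectorBundle {
  total_space : topologicalType;
  bundle_proj : total_space -> M;
  fibre : M -> vectType k;
  inc : forall x, fibre x -> total_space;
  bundle_proj_continuous : continuous bundle_proj;
  inc_bij : forall x, set_bij [set: fibre x] (bundle_proj @^-1` [set x]) (@inc x);
  bundle_trivial : forall x, exists (U : set M) (n : nat)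
      (phi : M * 'rV[k]_n -> total_space),
    [/\ open_nbhs x U, homeo_on (U `*` setT) (bundle_proj @^-1` U) phi &
        forall y, U y -> exists f : {linear 'rV[k]_n -> fibre y},
          forall v, phi (y, v) = inc (f v)] }.

(* The standard topology of a finite-dimensional vector space, transported
   from [k^n] by coordinates in a basis. *)
Definition fd_topology (k : numFieldType) (V : vectType k) : topologicalType :=
  initial_topology (passmx.rVof (vbasis {:V}) : V -> 'rV[k]_(\dim {:V})).

Record const_rank_map (k : numFieldType) (V : vectType k) (M : topologicalType)
    (E : vector_bundle k M) := ConstRankMap {
  ev_map :> forall x, 'Hom(V, fibre E x);
  ev_continuous :
    continuous (fun u : fd_topology V * M => inc (ev_map u.2 (u.1 : V)));
  ev_rank : exists r : nat, forall x, \dim (limg (ev_map x)) = r }.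

Record config (R : realType) (M : metricType R) := Config {
  carrier :> set M;
  config_compact : compact carrier;
  config_nonempty : carrier !=set0 }.

Section Hausdorff_metric.
Context (R : realType) (M : metricType R).
Implicit Types (K L P : config M) (e : R).

Definition hausdorff_within (K L : set M) : set R := [set e : R | 0 <= e /\
  (forall x, K x -> exists2 y, L y & mdist x y <= e) /\
  (forall y, L y -> exists2 x, K x & mdist x y <= e)].

Definition hausdorff_dist (K L : set M) : R := inf (hausdorff_within K L).

HB.instance Definition _ := gen_eqMixin (config M).
HB.instance Definition _ := gen_choiceMixin (config M).

Lemma config_eq K L : (K : set M) = L -> K = L.
Proof.
case: K L => [A ca na] [B cb nb] /= eAB; case: _ / eAB cb nb => cb nb.
by rewrite (Prop_irrelevance ca cb) (Prop_irrelevance na nb).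
Qed.

Lemma hausdorff_within_has_inf K L : has_inf (hausdorff_within K L).
Proof.
split; last by exists 0 => e [].
have bnd (P : config M) (x0 : M) : exists2 b : R, 0 <= b & forall x, carrier P x -> mdist x0 x <= b.
  have ctd : continuous (fun x : M => mdist x0 x : R).
    move=> x; apply/cvgrPdist_lt => e e0; near=> y.
    have : mdist x y < e.
      near: y; have := nbhsx_ballx x e e0; by rewrite ballEmdist.
    apply: le_lt_trans; have := metric_triangle x0 x y.
    have := metric_triangle x0 y x; rewrite (metric_sym y x) ler_norml.
    lra.
  have [|c Pc mc] := compact_EVT_max (config_nonempty P) (@config_compact _ _ P)
    (f := fun x : M => mdist x0 x : R).
    exact: continuous_subspaceT.
  by exists (mdist x0 c) => [|x Px]; [exact: mdist_ge0|apply: mc; rewrite inE].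
have [x0 Kx0] := config_nonempty K; have [y0 Ly0] := config_nonempty L.
have [b b0 bL] := bnd L x0; have [c c0 cK] := bnd K y0.
exists (b + c); split; first exact: addr_ge0.
split=> [x Kx|y Ly].
  exists y0 => //; rewrite metric_sym (le_trans (cK _ Kx))//.
  by rewrite lerDr.
by exists x0 => //; rewrite (le_trans (bL _ Ly))// lerDl.
Unshelve. all: by end_near. Qed.

Lemma hausdorff_within_sym K L : hausdorff_within K L = hausdorff_within L K.
Proof.
by apply/seteqP; split=> e [e0 [h1 h2]]; do !split=> //;
  [move=> x /h2|move=> x /h1|move=> x /h2|move=> x /h1] => -[y hy xy];
  exists y => //; rewrite metric_sym.
Qed.

Lemma hausdorff_dist_ge0 K L : 0 <= hausdorff_dist K L.
Proof.
apply: lb_le_inf; first exact: (hausdorff_within_has_inf K L).1.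
by move=> e [].
Qed.

Lemma hausdorff_distxx K : hausdorff_dist K K = 0.
Proof.
apply/eqP; rewrite eq_le hausdorff_dist_ge0 andbT.
apply: ge_inf; first exact: (hausdorff_within_has_inf K K).2.
by split=> //; split=> x Kx; exists x; rewrite ?mdistxx.
Qed.

Lemma hausdorff_dist_eq0_sub K L : hausdorff_dist K L = 0 -> K `<=` L.
Proof.
move=> d0 x Kx.
have cL : closed L.
  apply: compact_closed; [exact: (@metric_hausdorff R M)|exact: config_compact].
apply: cL => U /nbhs_ballP[e /= e0 eU].
have [r [r0 [h1 _]] re] := inf_adherent e0 (hausdorff_within_has_inf K L).
have [y Ly xy] := h1 _ Kx; exists y; split=> //; apply: eU.
rewrite ballEmdist /=; apply: (le_lt_trans xy).
by rewrite -[e]add0r -{1}d0.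
Qed.

Lemma hausdorff_dist_sym K L : hausdorff_dist K L = hausdorff_dist L K.
Proof. by rewrite /hausdorff_dist hausdorff_within_sym. Qed.

Lemma hausdorff_dist_eq0 K L : hausdorff_dist K L = 0 -> K = L.
Proof.
move=> d0; apply/config_eq/seteqP; split; apply: hausdorff_dist_eq0_sub => //.
by rewrite hausdorff_dist_sym.
Qed.

Lemma hausdorff_dist_triangle L K P :
  hausdorff_dist K P <= hausdorff_dist K L + hausdorff_dist L P.
Proof.
apply/ler_addgt0Pl => e e0; have e20 : 0 < e / 2 by rewrite divr_gt0.
have [a [a0 [a1 a2]] ae] := inf_adherent e20 (hausdorff_within_has_inf K L).
have [b [b0 [b1 b2]] be] := inf_adherent e20 (hausdorff_within_has_inf L P).
apply: (@le_trans _ _ (a + b)); last first.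
  by move: ae be; rewrite -!/(hausdorff_dist _ _); lra.
apply: ge_inf; first exact: (hausdorff_within_has_inf K P).2.
split; first exact: addr_ge0.
split=> [x /a1[y Ly xy]|z /b2[y Ly yz]].
  have [z Pz yz] := b1 _ Ly; exists z => //.
  by rewrite (le_trans (metric_triangle x y z))// lerD.
have [x Kx xy] := a2 _ Ly; exists x => //.
by rewrite (le_trans (metric_triangle x y z))// lerD.
Qed.

HB.instance Definition _ := @isMetric.Build R (config M) hausdorff_dist
  hausdorff_distxx hausdorff_dist_eq0 hausdorff_dist_sym
  hausdorff_dist_triangle.

End Hausdorff_metric.

Section Conditions.
Context (R : realType) (k : numFieldType) (V : vectType k) (M : metricType R).
Context (E : vector_bundle k M) (ev : const_rank_map V E).
Implicit Types (X Y : nat -> set (config M)) (K G : config M).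

Definition vanishing (K : set M) : set V :=
  [set f | forall x, K x -> f \in lker (ev x)].

Definition Sing (f : V) : set M := [set x | f \in lker (ev x)].

(* Sequences are indexed from 1; the values of [X] outside the range
   [1 <= i <= N] are irrelevant. *)
Definition upto X (m : nat) : set (config M) :=
  \bigcup_(j in [set j | (1 <= j <= m)%N]) X j.

Definition closures X (N : nat) : set (config M) :=
  upto (fun j => closure (X j)) N.

Definition cond1 X N := forall f : V, Sing f !=set0 ->
  exists2 K, upto X N K & carrier K = Sing f.

Definition cond2 X N := forall i j K K', (1 <= i <= N)%N -> (1 <= j <= N)%N ->
  X i K -> X j K' -> carrier K `<` K' -> (i < j)%N.

Definition cond3 X N := forall i, (1 <= i <= N)%N ->
  exists d : nat, forall K, X i K ->
    exists2 U : {vspace V}, vanishing K = [set` U] & \dim U = d.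

Definition cond4 X N := forall i j, (1 <= i <= N)%N -> (1 <= j <= N)%N ->
  i <> j -> X i `&` X j = set0.

(* [G] is the geometrisation of [K] with respect to [X 1, ..., X N]. *)
Definition is_geom X N K G :=
  [/\ upto X N G, carrier K `<=` G &
      forall G', upto X N G' -> carrier K `<=` G' -> carrier G `<=` G'].

Definition geometrisable X N := forall K, closures X N K ->
  exists2 G, is_geom X N K G & vanishing K = vanishing G.

Definition cond5_minus X N := geometrisable X N /\
  forall i K G, (1 <= i <= N)%N -> (closure (X i) `\` X i) K ->
    is_geom X N K G -> upto X i G.

Definition cond5 X N := geometrisable X N /\
  forall i K G, (1 <= i <= N)%N -> (closure (X i) `\` X i) K ->
    is_geom X N K G -> upto X i.-1 G.

Definition cond5_plus X N := forall i, (1 <= i <= N)%N ->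
  closure (X i) `<=` upto X i.

Definition A_set X N i : set (config M) :=
  [set K | closures X N K /\ exists2 K', upto X i K' & carrier K `<=` K'].

Definition T_set X i : set (M * config M) :=
  [set u | X i u.2 /\ carrier u.2 u.1].

Definition R_set X N i : set (config M * config M) :=
  [set u | [/\ A_set X N i u.1, X i u.2 & carrier u.1 `<=` u.2]].

Definition S_set X N i : set (config M * config M) :=
  [set u | [/\ A_set X N i.-1 u.1, X i u.2 & carrier u.1 `<=` u.2]].

End Conditions.

Section Bundles.
Context (F B : topologicalType).

(* [phi] trivialises the part of [Q], a subspace of [F * B], over the subset
   [U] of the base, with the fibre of [Q] over [b] as model fibre. *)
Definition trivialises (Q : set (F * B)) (U : set B) (b : B)
    (phi : F * B -> F * B) : Prop :=
  homeo_on ([set x | Q (x, b)] `*` U) (Q `&` snd @^-1` U) phi /\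
  forall x c, Q (x, b) -> U c -> (phi (x, c)).2 = c.

Definition locally_trivial (Q : set (F * B)) (X : set B) : Prop :=
  forall b, X b -> exists (O : set B) (phi : F * B -> F * B),
    open_nbhs b O /\ trivialises Q (X `&` O) b phi.

End Bundles.

(* A local trivialisation of [T_set X i] near [K0], normalised to be the
   identity over [K0], has the form [(x, K) |-> (theta K x, K)] with
   [theta K] a homeomorphism of [K0] onto [K].  The map it induces on pairs
   of configurations is [(K', K) |-> (theta K @` K', K)]. *)
Definition induces_trivialisation (R : realType) (M : metricType R)
    (theta : config M -> M -> M) (Q : set (config M * config M))
    (U : set (config M)) (K0 : config M) : Prop :=
  exists Theta : config M -> config M -> config M,
    (forall K K', U K -> Q (K', K0) -> carrier (Theta K K') = theta K @` K') /\
    trivialises Q U K0 (fun u => (Theta u.2 u.1, u.2)).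

Definition cond6 (R : realType) (M : metricType R)
    (X : nat -> set (config M)) (N : nat) : Prop :=
  forall i, (1 <= i <= N)%N ->
  [/\ locally_trivial (T_set X i) (X i),
      locally_trivial (R_set X N i) (X i),
      locally_trivial (S_set X N i) (X i) &
      forall K0, X i K0 ->
        exists (O : set (config M)) (theta : config M -> M -> M),
        [/\ open_nbhs K0 O,
            forall x, carrier K0 x -> theta K0 x = x,
            trivialises (T_set X i) (X i `&` O) K0
              (fun u => (theta u.2 u.1, u.2)),
            induces_trivialisation theta (R_set X N i) (X i `&` O) K0 &
            induces_trivialisation theta (S_set X N i) (X i `&` O) K0]].

Definition cond7 (R : realType) (M : metricType R)
    (X : nat -> set (config M)) (N : nat) : Prop :=
  forall i K K', (1 <= i <= N)%N -> X i K -> finite_set (carrier K) ->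
    carrier K' `<` K -> upto X i.-1 K'.

Section Self_joins.
Context (R : realType) (T : topologicalType) (n : nat).
Implicit Types (A : set T) (e : T -> 'rV[R]_n) (s : {fset T}).

(* The (possibly degenerate) simplex with vertices [e a], for [a] in [s]. *)
Definition simplex e s : set 'rV[R]_n :=
  [set \sum_(a <- s) t a *: e a | t in [set t : T -> R |
     (forall a, 0 <= t a) /\ \sum_(a <- s) t a = 1]].

Definition simplex_boundary e s : set 'rV[R]_n :=
  \bigcup_(s' in [set s' : {fset T} | (s' `<` s)%fset]) simplex e s'.

Definition barycentre e s : 'rV[R]_n :=
  (#|` s|%:R)^-1 *: \sum_(a <- s) e a.

Definition nondegenerate e s : Prop :=
  forall t : T -> R, \sum_(a <- s) t a = 0 -> \sum_(a <- s) t a *: e a = 0 ->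
    forall a, a \in s -> t a = 0.

(* Simplices with at most [m] vertices are considered throughout; when [A] has
   at least [m] points, these are the faces of the [(m-1)]-simplices. *)
Definition vertices_in A (m : nat) s : Prop := [set` s] `<=` A /\ (#|` s| <= m)%N.

Definition generic (m : nat) A e : Prop :=
  [/\ set_inj A e,
      forall s, vertices_in A m s -> nondegenerate e s &
      forall s s', vertices_in A m s -> vertices_in A m s' ->
        simplex e s `&` simplex e s' = simplex e (s `&` s')%fset].

Definition generic_embedding (m : nat) A e : Prop :=
  {within A, continuous e} /\ generic m A e.

Definition self_join (m : nat) A e : set 'rV[R]_n :=
  \bigcup_(s in vertices_in A m) simplex e s.

End Self_joins.

(* Below, [e] is the [N']-generic embedding of [upto Y N'] that defines its
   [N']-th self-join. *)
Section Cones.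
Context (R : realType) (M : metricType R) (n : nat) (e : config M -> 'rV[R]_n).
Context (X : nat -> set (config M)) (N : nat).
Context (Y : nat -> set (config M)) (N' : nat).
Implicit Types (K : config M) (s : {fset config M}).

Definition coherent s : Prop := vertices_in (upto Y N') N' s /\
  forall K K', K \in s -> K' \in s -> carrier K `<=` K' \/ carrier K' `<=` K.

Definition principal s K : Prop :=
  K \in s /\ forall K', K' \in s -> carrier K' `<=` K.

Definition tLambda K : set 'rV[R]_n :=
  \bigcup_(s in [set s | coherent s /\ principal s K]) simplex e s.

Definition tdLambda (i : nat) K : set 'rV[R]_n :=
  \bigcup_(K' in [set K' | upto Y i.-1 K' /\ carrier K' `<=` K]) tLambda K'.

Definition Lambda K : set 'rV[R]_n :=
  \bigcup_(s in [set s | [/\ coherent s, principal s K &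
      forall K', K' \in s -> K' <> K -> ~ is_geom X N K' K]]) simplex e s.

Definition dLambda (i : nat) K : set 'rV[R]_n :=
  \bigcup_(K' in [set K' | upto X i.-1 K' /\ carrier K' `<=` K]) tLambda K'.

Definition Phi (i : nat) : set 'rV[R]_n := \bigcup_(K in upto Y i) tLambda K.

End Cones.

(* Main.v *)
(* Write [K] in [X i], with [k0] points, as an ordered tuple of points of [M].
   Since all the non-empty subsets of [K] are configurations, [Lambda K] is the
   barycentric subdivision of the simplex on [K], and its points are described
   by an ordering [a_1, ..., a_k0] of [K] and weights [t_1, ..., t_k0] on the
   faces [{a_1, ..., a_j}].  The same data describe a point of the simplex
   spanned by [K] in the self-join of [M]: the combination with weights [t_j] of
   the barycentres of the faces.  Two such data define the same point on one side
   if and only if they do so on the other: genericity recovers the weight of each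
   face on the one side and the barycentric coordinates on the other, and
   either determines the other by sorting the vertices by decreasing coordinate.
   The data whose faces all lie in [upto Y N'] form a compact space, so both
   descriptions are quotient maps and the required maps are homeomorphisms.  A
   datum over a limit of [X i] outside [X i] cannot describe a point of the open
   stratum: its faces would have to include a configuration with [k0] points.
   The points of the stratum [Phi (alpha i)] minus [Phi (alpha i.-1)] are the
   data over [X i] with [t_k0 <> 0], because [Y j] is empty for
   [alpha i.-1 < j < alpha i]. *)

Require Import Defs.
From mathcomp Require Import all_boot all_order all_algebra finmap.
From mathcomp Require Import all_classical all_reals all_analysis.
From mathcomp Require Import lra zify.
Import Order.TTheory GRing.Theory Num.Theory.
Import numFieldNormedType.Exports.
Local Open Scope classical_set_scope.
Local Open Scope ring_scope.

Set Implicit Arguments.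
Unset Strict Implicit.
Unset Printing Implicit Defensive.

(** * Homeomorphisms parametrised by a compact space *)

Lemma image_compact_closed (S A : topologicalType) (C : set S) (p : S -> A)
    (Q : set S) :
  hausdorff_space A -> compact C -> {within C, continuous p} ->
  closed (Q : set (subspace C)) -> closed (p @` (C `&` Q)).
Proof.
move=> hA cC cp /closed_subspaceP[V clV VQ]; rewrite setIC -VQ setIC.
apply: compact_closed => //; apply: continuous_compact.
  exact: continuous_subspaceW (@subIsetl _ _ _) cp.
exact: compact_closedI.
Qed.

(* Preimages and images under [F] of closed sets are images of compact sets. *)
Lemma homeo_on_param (S A B : topologicalType) (C D : set S) (p : S -> A)
    (q : S -> B) (F : A -> B) :
  hausdorff_space A -> hausdorff_space B -> compact C -> D `<=` C ->
  {within C, continuous p} -> {within C, continuous q} ->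
  (forall c c', D c -> C c' -> p c = p c' <-> q c = q c') ->
  (forall c, D c -> F (p c) = q c) ->
  homeo_on (p @` D) (q @` D) F.
Proof.
move=> hA hB cC DC cp cq pq Fpq; split.
- apply/continuousP => O oO; apply/open_subspaceP.
  (* The removed set collects the parameters of all of [C], not only of [D], whose [q]-value avoids
     [O]. Since [pq] compares [D] with the whole of [C], no point of [D] over [O] is lost with
     them. *)
  exists (~` (p @` (C `&` q @^-1` ~` O))).
    rewrite openC; apply: image_compact_closed => //.
    by move/continuous_closedP: cq; apply; exact: open_closedC.
  apply/seteqP; split=> z [/= Oz [c Dc cz]]; rewrite -{z}cz in Oz *.
    split; last by exists c.
    apply: contrapT => nOF; apply: Oz; exists c => //; split; first exact: DC.
    by rewrite /= -Fpq.
  split; last by exists c.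
  by move=> [c' [Cc' nO] e]; apply: nO; rewrite /= -((pq c c' Dc Cc').1 (esym e)) -Fpq.
- split.
  + by move=> _ [c Dc <-] /=; exists c; rewrite ?Fpq.
  + move=> _ _ /set_mem[c Dc <-] /set_mem[d Dd <-].
    by rewrite !Fpq// => /pq; apply => //; exact: DC.
  + by move=> _ [c Dc <-]; exists (p c); [exists c|exact: Fpq].
- move=> U oU; exists (~` (q @` (C `&` p @^-1` ~` U))).
    rewrite openC; apply: image_compact_closed => //.
    by move/continuous_closedP: cp; apply; exact: open_closedC.
  apply/seteqP; split.
    move=> _ [_ [[c Dc <-] Uc] <-]; rewrite Fpq//; split; first by exists c.
    by move=> [c' [Cc' nU] e]; apply: nU; rewrite /= -((pq c c' Dc Cc').2 (esym e)).
  move=> _ [[c Dc <-] nU]; exists (p c); last exact: Fpq.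
  split; first by exists c.
  by apply: contrapT => nUc; apply: nU; exists c => //; split => //; exact: DC.
Qed.

Lemma factor_through (S A B : Type) (b0 : B) (D : set S) (p : S -> A)
    (q : S -> B) :
  (forall c c', D c -> D c' -> p c = p c' -> q c = q c') ->
  exists F : A -> B, forall c, D c -> F (p c) = q c.
Proof.
move=> pq; suff /choice[F FP] :
    forall z, exists y, forall c, D c -> p c = z -> q c = y.
  by exists F => c Dc; rewrite (FP (p c)).
move=> z; have [[c [Dc pc]]|nz] := pselect (exists c, D c /\ p c = z).
  by exists (q c) => c' Dc' pc'; apply: pq => //; rewrite pc pc'.
(* Off the image of [D] nothing is required, so [b0] serves as default value. *)
by exists b0 => c Dc pc; case: nz; exists c.
Qed.

(** * Compactness of finite CW-complexes *)

Lemma closed_disk_compact (R : realType) d : compact (closed_disk R d).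
Proof.
apply: bounded_closed_compact.
  exists 1; split => // r r1 x /= xd; apply: (@le_trans _ _ 1); last exact: ltW.
  rewrite /Num.norm /= mx_normrE; apply/bigmax_leP; split => //= -[i j] _ /=.
  rewrite (ord1 i) -(@expr_le1 _ 2)// -normrX ger0_norm ?sqr_ge0//.
  apply: le_trans xd; rewrite /sqnorm (bigD1 j)//= lerDl sumr_ge0// => *.
  exact: sqr_ge0.
have -> : closed_disk R d = (@sqnorm R d) @^-1` [set r | r <= 1] by [].
suff /continuous_closedP : continuous (@sqnorm R d) by apply; exact: closed_le.
apply: (continuous_big (op := +%R)) => [|j _]; first exact: add_continuous.
move=> x.
apply: (@continuous_comp _ _ _ (fun x : 'rV[R]_d => x 0 j) (fun r : R => r ^+ 2)).
  exact: coord_continuous.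
exact: exprn_continuous.
Qed.

(** The boundary of each cell lies in cells of lower dimension, so replacing open cells by images of
    closed disks does not enlarge the union; it becomes a finite union of compact sets. *)
Lemma finite_CW_compact (R : realType) (T : metricType R) (A : set T) :
  finite_CW A -> compact A.
Proof.
move=> [c [d [phi [/= cphi _ _ <- bd]]]].
set U := \bigcup_q _.
have -> : U = \big[setU/set0]_(q < c) (phi q @` closed_disk R (d q)).
  rewrite -big_enum -bigcup_seq; apply/seteqP; split=> z.
    move=> [q _ [x xd <-]]; exists q; first by rewrite /= mem_enum.
    by exists x => //; exact: ltW.
  move=> [q _ [x xd <-]]; have [x1|x1] := ltP (sqnorm x) 1.
    by exists q => //; exists x.
  have [|r _ [y yd yx]] := bd q (phi q x).
    by exists x => //; apply/eqP; rewrite eq_le x1 andbT.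
  by exists r => //; exists y.
apply: bigsetU_compact => q _; apply: continuous_compact => //.
exact: closed_disk_compact.
Qed.

(** * Generic families of points *)

Definition is_weight (R : realType) (p : nat) (u : 'I_p -> R) : Prop :=
  (forall j, 0 <= u j) /\ \sum_j u j = 1.

(** The push-forward of the weights along [v]. Families may repeat points, as degenerate limits of
    flags do, so weights must be added over the fibres of [v]. *)
Definition mass (R : realType) (T : choiceType) (p : nat) (u : 'I_p -> R)
    (v : 'I_p -> T) (x : T) : R :=
  \sum_(j | v j == x) u j.

Section Families.
Context (R : realType) (T : topologicalType) (n p : nat).
Implicit Types (u : 'I_p -> R) (v w : 'I_p -> T) (s : {fset T}) (x : T).
Implicit Types (e : T -> 'rV[R]_n) (A : set T).

Lemma mass_ge0 u v x : is_weight u -> 0 <= mass u v x.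
Proof. by move=> [u0 _]; apply: sumr_ge0. Qed.

Lemma sum_mass (V : lmodType R) (g : T -> V) u v s :
  (forall j, u j != 0 -> v j \in s) ->
  \sum_(x <- s) mass u v x *: g x = \sum_j u j *: g (v j).
Proof.
move=> us; under eq_bigr => x _ do rewrite scaler_suml.
rewrite (exchange_big_dep predT)//=; apply: eq_bigr => j _.
have [->|/us vs] := eqVneq (u j) 0.
  by rewrite scale0r big1// => x _; rewrite scale0r.
rewrite (eq_bigl (pred1 (v j))); last by move=> x; rewrite /= eq_sym.
by rewrite -big_filter filter_pred1_uniq ?big_seq1 ?fset_uniq.
Qed.

Lemma sum_mass1 u v s : is_weight u -> (forall j, u j != 0 -> v j \in s) ->
  \sum_(x <- s) mass u v x = 1.
Proof.
move=> [_ u1] us; have := sum_mass (fun=> 1 : R^o) us.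
under eq_bigr do rewrite /GRing.scale/= mulr1.
by under [RHS]eq_bigr do rewrite /GRing.scale/= mulr1; rewrite u1.
Qed.

Lemma simplex_family e u v s : is_weight u ->
  (forall j, u j != 0 -> v j \in s) ->
  simplex e s (\sum_j u j *: e (v j)).
Proof.
move=> wu us; exists (mass u v); last exact: sum_mass.
by split; [move=> x; exact: mass_ge0|exact: sum_mass1].
Qed.

(** By genericity the common point lies in the simplex on the shared vertices. Its coordinates
    there, extended by zero, must be the coordinates in each of the two simplices by
    non-degeneracy. *)
Lemma generic_coord m A e s s' (t t' : T -> R) : generic m A e ->
  vertices_in A m s -> vertices_in A m s' ->
  (forall a, 0 <= t a) -> \sum_(a <- s) t a = 1 ->
  (forall a, 0 <= t' a) -> \sum_(a <- s') t' a = 1 ->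
  \sum_(a <- s) t a *: e a = \sum_(a <- s') t' a *: e a ->
  forall x, (if x \in s then t x else 0) = (if x \in s' then t' x else 0).
Proof.
move=> [_ nd si] vs vs' t0 t1 t'0 t'1 tt'.
have : (simplex e s `&` simplex e s') (\sum_(a <- s) t a *: e a).
  by split; [exists t|exists t'].
rewrite si// => -[r [r0 r1] rt].
have key s1 (t1' : T -> R) : vertices_in A m s1 -> (s `&` s' `<=` s1)%fset ->
    \sum_(a <- s1) t1' a = 1 ->
    \sum_(a <- s) t a *: e a = \sum_(a <- s1) t1' a *: e a ->
    forall x, (if x \in s1 then t1' x else 0) =
              (if x \in (s `&` s')%fset then r x else 0).
  move=> vs1 sub t11 tt1 x; case: ifPn => [xs1|xs1]; last first.
    by case: ifP => // /(fsubsetP sub); rewrite (negbTE xs1).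
  (* The coordinates on the common face, extended by zero to [s1]. *)
  set r' := fun x => if x \in (s `&` s')%fset then r x else 0.
  apply/eqP; rewrite -subr_eq0; apply/eqP.
  apply: (nd _ vs1 (fun x => t1' x - r' x)) => //.
    rewrite sumrB t11 -(big_fset_incl _ sub); last first.
      by move=> y _ ys; rewrite /r' (negbTE ys).
    by rewrite (@eq_big_seq _ _ _ _ _ _ r) ?r1 ?subrr// => y; rewrite /r' => ->.
  under eq_bigr do rewrite scalerBl.
  rewrite sumrB -tt1 -rt -(big_fset_incl _ sub); last first.
    by move=> y _ ys; rewrite /r' (negbTE ys) scale0r.
  apply/eqP; rewrite subr_eq0; apply/eqP; apply: eq_big_seq => y ys.
  by rewrite /r' ys.
move=> x; rewrite (key s t)//; last exact: fsubsetIl.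
by rewrite (key s' t')//; exact: fsubsetIr.
Qed.

Definition range_fset v : {fset T} := [fset v j | j in 'I_p]%fset.

Lemma mem_range_fset v j : v j \in range_fset v.
Proof. by apply/imfsetP; exists j. Qed.

Lemma vertices_in_range_fset A m v : (p <= m)%N -> (forall j, A (v j)) ->
  vertices_in A m (range_fset v).
Proof.
move=> pm Av; split; first by move=> x /= /imfsetP[j _ ->].
apply: leq_trans pm; rewrite (leq_trans (leq_imfset_card _ _ _))//.
by rewrite /= -cardE card_ord.
Qed.

Lemma mass0_notin u v x : (forall j, v j != x) -> mass u v x = 0.
Proof. by move=> vx; rewrite /mass big_pred0// => j; exact/negbTE/vx. Qed.

Lemma mass_neq0 u v x : mass u v x != 0 -> exists2 j, v j = x & u j != 0.
Proof.
apply: contraPP => nj; apply/negP; rewrite negbK /mass big1// => j /eqP vj.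
by apply: contrapT => /eqP uj; apply: nj; exists j.
Qed.

Lemma mass_coord m A e u v s t : (p <= m)%N -> generic m A e ->
  (forall j, A (v j)) -> is_weight u -> vertices_in A m s ->
  (forall a, 0 <= t a) -> \sum_(a <- s) t a = 1 ->
  \sum_j u j *: e (v j) = \sum_(a <- s) t a *: e a ->
  forall x, mass u v x = if x \in s then t x else 0.
Proof.
move=> pm ge Av wu vs t0 t1 et x.
have su j : u j != 0 -> v j \in range_fset v by rewrite mem_range_fset.
rewrite -(generic_coord (t := mass u v) ge (vertices_in_range_fset pm Av) vs _ _ t0 t1 _ x)//.
- case: ifPn => // xv; rewrite mass0_notin// => j; apply: contraNneq xv => <-.
  exact: mem_range_fset.
- by move=> a; exact: mass_ge0.
- exact: sum_mass1.
- by rewrite sum_mass.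
Qed.

Lemma family_mass m A e u v u' w : (p <= m)%N -> generic m A e ->
  (forall j, A (v j)) -> (forall j, A (w j)) -> is_weight u -> is_weight u' ->
  \sum_j u j *: e (v j) = \sum_j u' j *: e (w j) ->
  mass u v =1 mass u' w.
Proof.
move=> pm ge Av Aw wu wu' ee x.
have sw j : u' j != 0 -> w j \in range_fset w by rewrite mem_range_fset.
rewrite (mass_coord pm ge Av wu (vertices_in_range_fset pm Aw) (t := mass u' w)).
- case: ifPn => // xv; rewrite mass0_notin// => j; apply: contraNneq xv => <-.
  exact: mem_range_fset.
- by move=> a; exact: mass_ge0.
- exact: sum_mass1.
- by rewrite sum_mass.
Qed.

(** Coordinates are unique, so a point of positive mass must be a vertex of any admissible simplex
    that contains the combination. *)
Lemma mem_simplex_mass m A e u v s : (p <= m)%N -> generic m A e ->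
  (forall j, A (v j)) -> is_weight u -> vertices_in A m s ->
  simplex e s (\sum_j u j *: e (v j)) ->
  forall x, mass u v x != 0 -> x \in s.
Proof.
move=> pm ge Av wu vs [t [t0 t1] te] x.
by rewrite (mass_coord pm ge Av wu vs t0 t1 (esym te)); case: ifP; rewrite ?eqxx.
Qed.

Lemma mass_inj u v j : injective v -> mass u v (v j) = u j.
Proof.
move=> vi; rewrite /mass (eq_bigl (pred1 j)) ?big_pred1_eq// => i /=.
by rewrite (inj_eq vi).
Qed.

Lemma sum_subrange (V : nmodType) (g : T -> V) v s : injective v ->
  (forall x, x \in s -> exists j, v j = x) ->
  \sum_(x <- s) g x = \sum_j if v j \in s then g (v j) else 0.
Proof.
move=> vi sv; rewrite (perm_big [seq v j | j <- index_enum 'I_p & v j \in s]).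
  by rewrite big_map big_filter big_mkcond.
apply: uniq_perm; first exact: fset_uniq.
  by rewrite map_inj_uniq ?filter_uniq ?index_enum_uniq.
move=> x; apply/idP/mapP => [xs|[j]]; last by rewrite mem_filter => /andP[? _] ->.
by have [j vj] := sv _ xs; exists j; rewrite // mem_filter mem_index_enum vj xs.
Qed.

Lemma simplex_coords e v s z : injective v ->
  (forall x, x \in s -> exists j, v j = x) -> simplex e s z ->
  exists u, [/\ is_weight u, forall j, u j != 0 -> v j \in s &
                z = \sum_j u j *: e (v j)].
Proof.
move=> vi sv [t [t0 t1] <-]; exists (fun j => if v j \in s then t (v j) else 0).
split; first split.
- by move=> j; case: ifP.
- by rewrite -(sum_subrange t vi sv).
- by move=> j; case: ifP; rewrite ?eqxx.
- rewrite (sum_subrange (fun x => t x *: e x) vi sv); apply: eq_bigr => j _.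
  by case: ifP; rewrite ?scale0r.
Qed.

End Families.

(** * Flags of finite configurations *)

Section Coefficients.
Context (R : realType) (k : nat).
Implicit Types (t c : 'I_k.+1 -> R).

(* If [t j] is the weight of the barycentre of the first [j.+1] vertices of a
   flag, then [vertex_weight t l] is the resulting weight of vertex [l]. *)
Definition vertex_weight t (l : nat) : R :=
  \sum_(j < k.+1 | (l <= j)%N) t j / j.+1%:R.

Lemma vertex_weight_rec t (j : 'I_k.+1) :
  vertex_weight t j = t j / j.+1%:R + vertex_weight t j.+1.
Proof.
rewrite /vertex_weight (bigD1 j)//=; congr (_ + _).
by apply: eq_bigl => i; rewrite ltn_neqAle andbC eq_sym.
Qed.

Lemma vertex_weight_max t : vertex_weight t k.+1 = 0.
Proof. by rewrite /vertex_weight big_pred0// => j; rewrite ltnNge leq_ord. Qed.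

Lemma vertex_weight_last t : vertex_weight t k = t ord_max / k.+1%:R.
Proof.
by have := vertex_weight_rec t ord_max; rewrite /= vertex_weight_max addr0.
Qed.

(** The term for [t j] is divided by [j.+1] and occurs for exactly the [j.+1] vertices up to [j]. *)
Lemma sum_vertex_weight t : \sum_(l < k.+1) vertex_weight t l = \sum_j t j.
Proof.
rewrite /vertex_weight (exchange_big_dep predT)//=; apply: eq_bigr => j _.
rewrite -(big_ord_widen k.+1 (fun=> t j / j.+1%:R) (ltn_ord j)).
by rewrite sumr_const card_ord -[_ / _ *+ _]mulr_natr divfK ?pnatr_eq0.
Qed.

Lemma vertex_weight_is_weight t : is_weight t ->
  is_weight (fun l : 'I_k.+1 => vertex_weight t l).
Proof.
move=> [t0 t1]; split=> [l|]; last by rewrite sum_vertex_weight.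
by apply: sumr_ge0 => j _; rewrite divr_ge0.
Qed.

Lemma le_vertex_weight t (i j : nat) : is_weight t -> (i <= j)%N ->
  vertex_weight t j <= vertex_weight t i.
Proof.
move=> [t0 _] ij; rewrite /vertex_weight [leRHS](bigID (fun l : 'I__ => j <= l)%N)/=.
rewrite -[leLHS]addr0 lerD ?sumr_ge0//; last by move=> l _; rewrite divr_ge0.
rewrite le_eqVlt; apply/orP; left; apply/eqP; apply: eq_bigl => l.
by case: (leqP j l) => jl; rewrite ?andbF ?andbT//; apply/esym/(leq_trans ij).
Qed.

Lemma vertex_weight_inj t t' :
  (forall l : 'I_k.+1, vertex_weight t l = vertex_weight t' l) -> t =1 t'.
Proof.
move=> tt' j.
have : vertex_weight t j.+1 = vertex_weight t' j.+1.
  have [jk|jk] := ltnP j.+1 k.+1; first exact: (tt' (Ordinal jk)).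
  have -> : j.+1 = k.+1 by apply/eqP; rewrite eqn_leq jk ltn_ord.
  by rewrite !vertex_weight_max.
have := tt' j; rewrite !vertex_weight_rec => + e; rewrite e => /addIr.
by move/mulIf; apply; rewrite invr_eq0 pnatr_eq0.
Qed.

(** The inverse is given by successive differences of the coordinates, rescaled by the size of the
    face; they are non-negative because the coordinates decrease. *)
Lemma vertex_weight_surj c : is_weight c ->
  (forall i j : 'I_k.+1, (i <= j)%N -> c j <= c i) ->
  exists2 t, is_weight t & forall l : 'I_k.+1, vertex_weight t l = c l.
Proof.
(* Padding by zero beyond index [k] makes the difference formula cover the last face too, and lets
   the sum telescope to [c l]. *)
move=> wc cd; pose d m := if (m <= k)%N then c (inord m) else 0.
have dc (l : 'I_k.+1) : d l = c l by rewrite /d leq_ord inord_val.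
pose t (j : 'I_k.+1) := j.+1%:R * (d j - d j.+1).
have tc (l : 'I_k.+1) : vertex_weight t l = c l.
  transitivity (\sum_(j < k.+1 | (l <= j)%N) - (d j.+1 - d j)).
    by apply: eq_bigr => j _; rewrite /t mulrC mulKf ?pnatr_eq0// opprB.
  rewrite sumrN -(big_geq_mkord _ _ xpredT (fun j => d j.+1 - d j)).
  by rewrite telescope_sumr ?(ltnW (ltn_ord l))// {1}/d ltnn sub0r opprK dc.
have t0 j : 0 <= t j.
  rewrite mulr_ge0// subr_ge0 /d leq_ord inord_val.
  case: ifPn => [jk|_]; last exact: wc.1.
  by apply: cd; rewrite inordK.
exists t => //; split => //.
by rewrite -sum_vertex_weight -wc.2; apply: eq_bigr => l _.
Qed.

End Coefficients.

(** * Initial segments of orderings *)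

Section Flags.
Context (R : realType) (M : metricType R) (k : nat).
Implicit Types (a b : 'I_k.+1 -> M) (i j l : 'I_k.+1) (K : config M).

Let initial_set a j : set M := a @` [set l : 'I_k.+1 | (l <= j)%N].

Lemma initial_compact a j : compact (initial_set a j).
Proof. by apply/finite_compact/finite_image. Qed.

Lemma initial_nonempty a j : initial_set a j !=set0.
Proof. by exists (a j); exists j => /=. Qed.

Definition initial a j : config M :=
  Config (@initial_compact a j) (initial_nonempty a j).

Lemma mem_initial a j l : injective a ->
  carrier (initial a j) (a l) <-> (l <= j)%N.
Proof.
by move=> ia; split=> [[m /= mj /ia <-]//|lj]; exists l.
Qed.

Lemma initial_last a : carrier (initial a ord_max) = range a.
Proof.
by apply/seteqP; split=> _ [l _ <-]; exists l => //=; exact: leq_ord.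
Qed.

Lemma initial_sub a i j : (i <= j)%N -> carrier (initial a i) `<=` initial a j.
Proof. by move=> ij _ [l /= li <-]; exists l => //=; exact: leq_trans li ij. Qed.

(** A count of points: the first segment has exactly [i.+1] of them, the second at most [j.+1]. The
    map [b] may repeat points, which is what allows degenerate limits. *)
Lemma leq_initial a b i j : injective a -> carrier (initial a i) `<=` initial b j ->
  (i <= j)%N.
Proof.
move=> ia ab.
have /choice[f fP] : forall l : 'I_i.+1, exists m : 'I_j.+1,
    b (inord m) = a (inord l).
  move=> l; have lk : (l < k.+1)%N by apply: leq_trans (ltn_ord l) _.
  have [|m /= mj bm] := ab (a (inord l)).
    by exists (inord l) => //=; rewrite inordK// -ltnS.
  by exists (inord m); rewrite inordK// inord_val.
have fi : injective f.
  move=> l l' ff; have := fP l'; rewrite -ff fP => /ia /(congr1 val) /=.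
  by rewrite !inordK ?(leq_trans (ltn_ord _))// => /val_inj.
by have := leq_card f fi; rewrite !card_ord.
Qed.

Lemma initial_inj a : injective a -> injective (initial a).
Proof.
move=> ia i j ij; apply/val_inj/eqP.
by rewrite eqn_leq; apply/andP; split; apply: (@leq_initial a a) => //; rewrite ij.
Qed.

Lemma leq_initial_eq a b i j : injective a -> injective b ->
  initial a i = initial b j -> i = j.
Proof.
move=> ia ib ij; apply/val_inj/eqP.
rewrite eqn_leq; apply/andP; split.
  by apply: (@leq_initial a b) => //; rewrite ij.
by apply: (@leq_initial b a) => //; rewrite ij.
Qed.

(** A choice of indices in [b] for the points of [a] is an injective self-map of a finite set, hence
    a bijection. *)
Lemma covering_enum a b : injective a -> (forall l, exists m, b m = a l) ->
  injective b /\ range b = range a.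
Proof.
move=> ia /choice[f bf].
have fi : injective f by move=> l l' ff; apply: ia; rewrite -!bf ff.
have [g fK gK] := injF_bij fi; split.
  by move=> m m'; rewrite -(gK m) -(gK m') !bf => /ia ->.
apply/seteqP; split=> _ [m _ <-]; first by exists (g m) => //; rewrite -bf gK.
by exists (f m).
Qed.

Lemma enumeration_inj a (K : set M) : (K #= `I_k.+1)%card -> range a = K ->
  injective a.
Proof.
move=> Kk aK; have fK : finite_set K by exists k.+1.
apply/injectiveP; rewrite /injectiveb /dinjectiveb.
rewrite (@uniq_size_uniq _ (fset_set K)) ?fset_uniq//.
  by rewrite (card_fset_set Kk) size_map -cardE card_ord.
move=> x; rewrite in_fset_set// -aK; apply/idP/mapP.
  by rewrite inE => -[l _ <-]; exists l; rewrite ?mem_enum.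
by move=> [l _ ->]; rewrite inE; exists l.
Qed.

Lemma sum_initial (V : nmodType) (g : M -> V) a j : injective a ->
  \sum_(l < k.+1 | (l <= j)%N) g (a l) = \sum_(x <- fset_set (initial a j)) g x.
Proof.
move=> ia; have fin : finite_set (initial a j) by exact: finite_image.
rewrite (sum_subrange g ia) => [|x]; last first.
  by rewrite in_fset_set// inE => -[l _ <-]; exists l.
rewrite big_mkcond; apply: eq_bigr => l _; rewrite in_fset_set//.
by congr (if _ then _ else _); apply/idP/idP; rewrite inE => /(mem_initial _ _ ia).
Qed.

Lemma sorted_enum (K : set M) (f : M -> R) : (K #= `I_k.+1)%card ->
  exists a, [/\ injective a, range a = K &
                forall i j, (i <= j)%N -> f (a j) <= f (a i)].
Proof.
move=> Kk; have fK : finite_set K by exists k.+1.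
have cK : size (fset_set K) = k.+1 by exact: card_fset_set.
pose r := [rel x y | f y <= f x].
have rt : total r by move=> x y; exact: le_total.
pose s := sort r (fset_set K).
have ss : size s = k.+1 by rewrite size_sort.
have sK x : (x \in s) = (x \in K) by rewrite mem_sort in_fset_set.
have [x0 _] : K !=set0.
  by apply/set0P; apply: contra_eq_neq cK => ->; rewrite fset_set0.
exists (fun i => nth x0 s i); split.
- move=> i j /eqP; rewrite nth_uniq ?ss// ?sort_uniq ?fset_uniq//.
  by move=> /eqP /val_inj.
- apply/seteqP; split=> [_ [i _ <-]|x Kx].
    by apply/set_mem; rewrite -sK mem_nth ?ss.
  have xs : x \in s by rewrite sK inE.
  have xk : (index x s < k.+1)%N by rewrite -ss index_mem.
  by exists (Ordinal xk) => //=; rewrite nth_index.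
- move=> i j ij; apply: (@sorted_leq_nth _ r) => //; rewrite ?inE ?ss//.
  + by move=> y x z /= yx zy; exact: le_trans zy yx.
  + by move=> x /=.
  + exact: sort_sorted.
Qed.

(* Ordering the points of [K] by the number of members of the chain that contain
   them makes every member an initial segment. *)
Lemma chain_enum K (s : {fset config M}) : (carrier K #= `I_k.+1)%card ->
  (forall L, L \in s -> carrier L `<=` K) ->
  (forall L L', L \in s -> L' \in s -> carrier L `<=` L' \/ carrier L' `<=` L) ->
  exists a, [/\ injective a, range a = K &
                forall L, L \in s -> exists j, initial a j = L].
Proof.
move=> Kk sK ch.
pose above x : {fset config M} := [fset L in s | x \in carrier L]%fset.
have aboveP x L : (L \in above x) = (L \in s) && (x \in carrier L).
  by rewrite !inE.
have [a [ia aK ad]] := sorted_enum (fun x => (#|` above x|)%:R) Kk.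
exists a; split => // L Ls.
have [x Lx] := config_nonempty L.
have [l0 _ al0] : range a x by rewrite aK; exact: sK Lx.
have Ll0 : a l0 \in carrier L by rewrite inE al0.
exists [arg max_(l > l0 | a l \in carrier L) (l : nat)].
case: arg_maxnP => //= j /set_mem Lj jmax.
apply/config_eq/seteqP; split=> [_ [l /= lj <-]|y Ly]; last first.
  have [l _ al] : range a y by rewrite aK; exact: sK Ly.
  by exists l => //=; apply: jmax; rewrite al inE.
(* With [j] the last index whose point lies in [L], suppose an earlier [a l] is outside [L]. Every
   member of the chain containing [a l] then contains [L], hence [a j], while [L] contains only
   [a j]. So strictly more members contain [a j], against the sorting. *)
apply: contrapT => nLl; have := ad _ _ lj.
rewrite ler_nat leqNgt => /negP; apply.
apply: fproper_ltn_card; rewrite fproperE; apply/andP; split.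
  apply/fsubsetP; move=> L'; rewrite !aboveP => /andP[L's /set_mem L'l]; rewrite L's inE/=.
  have [LL'|L'L] := ch _ _ Ls L's; first exact: LL'.
  by exfalso; apply: nLl; exact: L'L.
apply/fsubsetPn; exists L; rewrite aboveP Ls ?inE//.
by apply/negP => /set_mem.
Qed.

End Flags.

(** * Weighted flags *)

Section Parametrisation.
Context (R : realType) (M : metricType R) (k : nat).

(* A point of the barycentric subdivision of a simplex: an ordering of the
   vertices, that is, a full flag of faces, and a weight for each face. *)
Local Notation weighted_flag := {ptws 'I_k.+1 -> (M * R)%type}.

Implicit Types (c : weighted_flag) (Z : set (config M)) (K : config M).

Definition vert c (l : 'I_k.+1) : M := (c l).1.
Definition wt c (j : 'I_k.+1) : R := (c j).2.
Definition face c (j : 'I_k.+1) : config M := initial (vert c) j.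

Definition flag_point n (e : config M -> 'rV[R]_n) c : 'rV[R]_n :=
  \sum_j wt c j *: e (face c j).

Definition bary_point n (e : M -> 'rV[R]_n) c : 'rV[R]_n :=
  \sum_j wt c j *: (j.+1%:R^-1 *: \sum_(l < k.+1 | (l <= j)%N) e (vert c l)).

Lemma bary_pointE n (e : M -> 'rV[R]_n) c :
  bary_point e c = \sum_(l < k.+1) vertex_weight (wt c) l *: e (vert c l).
Proof.
rewrite /vertex_weight; under [RHS]eq_bigr do rewrite scaler_suml.
rewrite (exchange_big_dep predT)//=; apply: eq_bigr => j _.
by rewrite scalerA scaler_sumr.
Qed.

(** Repeated vertices are allowed, so that the set is closed whenever [Z] is. *)
Definition flags Z : set weighted_flag :=
  [set c | is_weight (wt c) /\ forall j, Z (face c j)].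

Definition open_flags (S : set (config M)) : set weighted_flag :=
  [set c | [/\ is_weight (wt c), S (face c ord_max) & wt c ord_max != 0]].

Lemma wt_continuous j : continuous (fun c => wt c j).
Proof.
move=> c; apply: (@continuous_comp _ _ _ (fun c : weighted_flag => c j) snd).
  exact: (@proj_continuous _ (fun=> (M * R)%type)).
exact: cvg_snd.
Qed.

Lemma vert_continuous l : continuous (fun c => vert c l).
Proof.
move=> c; apply: (@continuous_comp _ _ _ (fun c : weighted_flag => c l) fst).
  exact: (@proj_continuous _ (fun=> (M * R)%type)).
exact: cvg_fst.
Qed.

(** Moving each vertex by less than [r / 2] moves every initial segment by at most [r / 2] in the
    Hausdorff distance. *)
Lemma face_continuous j : continuous (fun c => face c j).
Proof.
move=> c B /nbhs_ballP[r /= r0 rB].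
have near_c : \forall c' \near c, forall l, ball (vert c l) (r / 2) (vert c' l).
  apply: (@filter_forall _ 'I_k.+1
    (fun l c' => ball (vert c l) (r / 2) (vert c' l)) _ (nbhs_filter c)) => l.
  by apply: vert_continuous; apply: nbhsx_ballx; rewrite divr_gt0.
apply: filterS near_c => c' c'c; apply: rB; rewrite ballEmdist /=.
apply: (@le_lt_trans _ _ (r / 2)); last by lra.
have cc' l : mdist (vert c l) (vert c' l) <= r / 2.
  by have := c'c l; rewrite ballEmdist => /ltW.
apply: ge_inf; first exact: (hausdorff_within_has_inf _ _).2.
split; first by lra.
split=> _ [l lj <-]; first by exists (vert c' l) => //; exists l.
by exists (vert c l) => //; exists l.
Qed.

(** A closed subset of a finite power of the product of [M] with the unit interval. *)
Lemma flags_compact Z : compact [set: M] -> closed Z -> compact (flags Z).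
Proof.
move=> cM cZ.
have cbox : compact [set c : weighted_flag | forall j,
    ([set: M] `*` `[0, 1]%classic) (c j)].
  apply: (@tychonoff _ (fun=> (M * R)%type) (fun=> [set: M] `*` `[0, 1]%classic)).
  by move=> _; apply: compact_setX => //; exact: segment_compact.
apply: (subclosed_compact _ cbox); last first.
  move=> c [[t0 t1] _] j; split => //=; rewrite in_itv/= t0 -t1.
  by rewrite (bigD1 j)//= lerDl sumr_ge0.
have -> : flags Z = (\bigcap_(j in [set: 'I_k.+1]) (wt^~ j @^-1` [set r | 0 <= r]))
    `&` ((fun c => \sum_j wt c j) @^-1` [set 1])
    `&` (\bigcap_(j in [set: 'I_k.+1]) (face^~ j @^-1` Z)).
  apply/seteqP; split=> [c [[t0 t1] cF]|c [[t0 t1] cF]].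
    by split=> [|j _]; [split=> // j _; exact: t0|exact: cF].
  by split=> [|j]; [split=> // j; exact: t0|exact: cF].
apply: closedI; first apply: closedI.
- apply: closed_bigI => j _.
  by move/continuous_closedP: (@wt_continuous j); apply; exact: closed_ge.
- suff /continuous_closedP : continuous (fun c => \sum_j wt c j).
    by apply; exact: closed_eq.
  apply: (continuous_big (op := +%R)) => [|j _]; first exact: add_continuous.
  exact: wt_continuous.
- apply: closed_bigI => j _.
  by move/continuous_closedP: (@face_continuous j); apply.
Qed.

Lemma flag_point_continuous n (e : config M -> 'rV[R]_n) Z :
  {within Z, continuous e} -> {within flags Z, continuous (flag_point e)}.
Proof.
move=> /subspace_continuousP ce; apply/subspace_continuousP => c cZ.
apply: (cvg_big (@add_continuous 'rV[R]_n)) => j _.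
apply: cvgZ; first by apply: cvg_within_filter; exact: wt_continuous.
apply: cvg_trans (ce (face c j) (cZ.2 j)).
move=> B /= nB; rewrite /nbhs/= /within/=.
have := @face_continuous j c _ nB.
apply: (@filterS _ _ (nbhs_filter c)) => c' Bc' [_ c'Z]; exact: Bc'.
Qed.

Lemma bary_point_continuous n (e : M -> 'rV[R]_n) :
  continuous e -> continuous (bary_point e).
Proof.
move=> ce; apply: (continuous_big (@add_continuous 'rV[R]_n)) => j _.
move=> c; apply: (cvgZ (FF := nbhs_filter c)); first exact: wt_continuous.
apply: (cvgZ (FF := nbhs_filter c)); first exact: cvg_cst.
apply: (cvg_big (@add_continuous 'rV[R]_n)) => l _.
by apply: continuous_comp; [exact: vert_continuous|exact: ce].
Qed.

(** Faces of weight zero are left free: they contribute to neither point, and a partial flag has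
    many refinements. *)
Definition same_faces c c' : Prop := forall j,
  wt c j = wt c' j /\ (wt c j != 0 -> face c j = face c' j).

Lemma same_faces_flag_point n (e : config M -> 'rV[R]_n) c c' :
  same_faces c c' -> flag_point e c = flag_point e c'.
Proof.
move=> cc'; apply: eq_bigr => j _; have [<- ff] := cc' j.
by have [->|/ff ->//] := eqVneq (wt c j) 0; rewrite !scale0r.
Qed.

(** The average over a face runs over positions in the ordering; it depends on the set alone once
    the vertices are distinct. *)
Lemma same_faces_bary_point n (e : M -> 'rV[R]_n) c c' :
  injective (vert c) -> injective (vert c') ->
  same_faces c c' -> bary_point e c = bary_point e c'.
Proof.
move=> ic ic' cc'; apply: eq_bigr => j _; have [<- ff] := cc' j.
have [->|/ff fj] := eqVneq (wt c j) 0; first by rewrite !scale0r.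
by rewrite (sum_initial e j ic) (sum_initial e j ic') -!/(face _ _) fj.
Qed.

Section Flag_points.
Context (n m : nat) (e : config M -> 'rV[R]_n) (Z : set (config M)).
Hypotheses (km : (k < m)%N) (ge : generic m Z e).

(** The masses agree, and in an injective flag each face carries only its own weight. A face
    occurring in both flags has the same index in both, as its cardinality determines the index. *)
Lemma flag_point_same_faces c c' : flags Z c -> flags Z c' ->
  injective (vert c) -> injective (vert c') ->
  flag_point e c = flag_point e c' -> same_faces c c'.
Proof.
move=> [wc Zc] [wc' Zc'] ic ic' cc'.
have mm := family_mass km ge Zc Zc' wc wc' cc'.
have key d d' (j : 'I_k.+1) : injective (vert d) -> injective (vert d') ->
    mass (wt d) (face d) =1 mass (wt d') (face d') ->
    wt d j != 0 -> face d j = face d' j /\ wt d j = wt d' j.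
  move=> id id' dd' dj.
  have idj := initial_inj id; have idj' := initial_inj id'.
  have dm : mass (wt d) (face d) (face d j) = wt d j by exact: mass_inj.
  have [|j' fj' _] := @mass_neq0 _ _ _ (wt d') (face d') (face d j).
    by rewrite -dd' dm.
  have jj' := leq_initial_eq id' id fj'; rewrite jj' in fj'.
  by split => //; rewrite -dm dd' -fj'; exact: mass_inj.
move=> j; have [c0|cj] := eqVneq (wt c j) 0; last by have [] := key c c' j ic ic' mm cj.
split=> //.
apply/esym/eqP; rewrite c0; apply: contraT => c'j.
have [|_ c'c] := key c' c j ic' ic _ c'j; first by move=> x; rewrite mm.
by rewrite c'c c0 eqxx in c'j.
Qed.

(** Here [c'] may be degenerate. The top face of [c] has positive mass, so it is a face of [c'];
    having [k.+1] points, it must be the top one, and the vertices of [c'] are distinct. *)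
Lemma flag_point_range c c' : flags Z c -> flags Z c' ->
  injective (vert c) -> wt c ord_max != 0 ->
  flag_point e c = flag_point e c' ->
  injective (vert c') /\ face c' ord_max = face c ord_max.
Proof.
move=> [wc Zc] [wc' Zc'] ic cl cc'.
have mm := family_mass km ge Zc Zc' wc wc' cc'.
have ifc := initial_inj ic.
have dm : mass (wt c) (face c) (face c ord_max) = wt c ord_max by exact: mass_inj.
have [|j fj _] := @mass_neq0 _ _ _ (wt c') (face c') (face c ord_max).
  by rewrite -mm dm.
have jl : j = ord_max.
  apply/val_inj/eqP; rewrite eqn_leq leq_ord /=.
  by apply: (@leq_initial _ _ _ (vert c) (vert c') ord_max) => //; rewrite -/(face c' j) fj.
have cover : forall l, exists i, vert c' i = vert c l.
  move=> l; have : carrier (face c ord_max) (vert c l).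
    by rewrite /face initial_last; exists l.
  by rewrite -fj => -[i _ <-]; exists i.
split; first exact: (covering_enum ic cover).1.
by rewrite -fj jl.
Qed.

End Flag_points.

Section Bary_points.
Context (n : nat) (e : M -> 'rV[R]_n).
Hypothesis ge : generic k.+1 [set: M] e.

Lemma bary_point_mass c c' : is_weight (wt c) -> is_weight (wt c') ->
  bary_point e c = bary_point e c' ->
  mass (fun l : 'I_k.+1 => vertex_weight (wt c) l) (vert c) =1
  mass (fun l : 'I_k.+1 => vertex_weight (wt c') l) (vert c').
Proof.
move=> wc wc'; rewrite !bary_pointE.
by apply: family_mass ge _ _ _ _ => //; exact: vertex_weight_is_weight.
Qed.

(** The coordinates decrease along the flag and drop strictly after a face of non-zero weight, so
    that face is a superlevel set. *)
Lemma face_level c j : is_weight (wt c) -> injective (vert c) -> wt c j != 0 ->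
  carrier (face c j) = [set x | carrier (face c ord_max) x /\
    vertex_weight (wt c) j <=
      mass (fun l : 'I_k.+1 => vertex_weight (wt c) l) (vert c) x].
Proof.
move=> wc ic cj; rewrite /face initial_last; apply/seteqP; split.
  by move=> _ [l lj <-]; split; [exists l|rewrite mass_inj//; exact: le_vertex_weight].
move=> _ [[l _ <-]]; rewrite mass_inj// => le; apply/mem_initial => //.
rewrite leqNgt; apply/negP => jl.
have := le_trans le (le_vertex_weight wc jl).
rewrite vertex_weight_rec leNgt ltrDr => /negP; apply.
by rewrite divr_gt0// lt0r cj wc.1.
Qed.

(** Both flags list the same coordinates of the same vertices in decreasing order, so the two lists
    coincide. This determines the weights, and the faces of non-zero weight are then superlevel
    sets. *)
Lemma bary_point_same_faces c c' : is_weight (wt c) -> is_weight (wt c') ->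
  injective (vert c) -> injective (vert c') ->
  face c ord_max = face c' ord_max ->
  bary_point e c = bary_point e c' -> same_faces c c'.
Proof.
move=> wc wc' ic ic' ff /(bary_point_mass wc wc') mm.
set u := fun l : 'I_k.+1 => vertex_weight (wt c) l in mm.
set u' := fun l : 'I_k.+1 => vertex_weight (wt c') l in mm.
have uu' : u =1 u'.
  have rr : range (vert c) = range (vert c') by rewrite -!initial_last -!/(face _ _) ff.
  pose r := [rel x y : R | y <= x].
  have sr d : is_weight (wt d) ->
      sorted r (codom (fun l : 'I_k.+1 => vertex_weight (wt d) l)).
    move=> wd; have -> : codom (fun l : 'I_k.+1 => vertex_weight (wt d) l) =
        [seq vertex_weight (wt d) i | i <- iota 0 k.+1].
      by rewrite -val_enum_ord -map_comp codomE.
    apply/(sortedP 0) => i; rewrite size_map size_iota => ik.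
    rewrite !(nth_map 0%N) ?size_iota// ?(ltnW ik)// !nth_iota// ?(ltnW ik)//=.
    exact: le_vertex_weight.
  have cod (v : 'I_k.+1 -> R) d : injective (vert d) ->
      codom v = map (mass v (vert d)) (codom (vert d)).
    move=> id; rewrite !codomE -(map_comp (mass v (vert d))); apply: eq_map => l /=.
    by rewrite mass_inj.
  suff uu : codom u = codom u'.
    move=> l; have := congr1 (fun s => nth 0 s (enum_rank l)) uu.
    by rewrite !nth_codom !enum_rankK.
  apply: (@sorted_eq _ r) => //.
  - by move=> y x z /= yx zy; exact: le_trans zy yx.
  - by move=> x y /= /andP[xy yx]; apply/eqP; rewrite eq_le xy yx.
  - exact: sr.
  - exact: sr.
  rewrite (cod u c ic) (cod u' c' ic').
  rewrite (eq_map mm); apply/perm_map/uniq_perm.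
  - by rewrite codomE map_inj_uniq ?enum_uniq.
  - by rewrite codomE map_inj_uniq ?enum_uniq.
  - move=> x; apply/codomP/codomP => -[l ->].
      have : range (vert c) (vert c l) by exists l.
      by rewrite rr => -[l' _ <-]; exists l'.
    have : range (vert c') (vert c' l) by exists l.
    by rewrite -rr => -[l' _ <-]; exists l'.
have tt : wt c =1 wt c' by exact: vertex_weight_inj.
move=> j; split=> // cj; apply/config_eq.
have c'j : wt c' j != 0 by rewrite -tt.
rewrite (face_level wc ic cj) (face_level wc' ic' c'j) ff -/u -/u'.
by apply/seteqP; split=> x /=; rewrite mm -[vertex_weight (wt c) j]/(u j) uu'.
Qed.

(** A non-zero top weight makes every coordinate positive, so each vertex of [c] occurs among those
    of [c']. *)
Lemma bary_point_range c c' : is_weight (wt c) -> is_weight (wt c') ->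
  injective (vert c) -> wt c ord_max != 0 ->
  bary_point e c = bary_point e c' ->
  injective (vert c') /\ face c' ord_max = face c ord_max.
Proof.
move=> wc wc' ic cl /(bary_point_mass wc wc') mm.
have cover : forall l, exists i, vert c' i = vert c l.
  move=> l; have [|i ci _] := @mass_neq0 _ _ _
      (fun l : 'I_k.+1 => vertex_weight (wt c') l) (vert c') (vert c l).
    rewrite -mm mass_inj// gt_eqF//.
    apply: (@lt_le_trans _ _ (vertex_weight (wt c) k)).
      by rewrite vertex_weight_last divr_gt0// lt0r cl wc.1.
    by apply: le_vertex_weight => //; exact: leq_ord.
  by exists i.
have [ic' rr] := covering_enum ic cover; split => //.
by apply: config_eq; rewrite /face !initial_last.
Qed.

End Bary_points.

End Parametrisation.

(** * Simplices and their subdivisions *)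

Section Simplices.
Context (R : realType) (M : metricType R) (k : nat) (K : config M).
Local Notation weighted_flag := {ptws 'I_k.+1 -> (M * R)%type}.
Hypothesis cardK : (carrier K #= `I_k.+1)%card.
Implicit Types c : weighted_flag.

Definition flags_of : set weighted_flag :=
  [set c | is_weight (wt c) /\ face c ord_max = K].

Definition boundary_flags_of : set weighted_flag :=
  flags_of `&` [set c | wt c ord_max = 0].

Lemma flags_of_inj c : flags_of c -> injective (vert c).
Proof.
by move=> [_ cK]; apply: enumeration_inj cardK _; rewrite -initial_last -cK.
Qed.

Lemma face_sub c j : flags_of c -> carrier (face c j) `<=` K.
Proof. by move=> [_ <-]; apply: initial_sub; exact: leq_ord. Qed.

Lemma mem_vert c l : flags_of c -> carrier K (vert c l).
Proof. by move=> [_ <-]; exists l => //=; exact: leq_ord. Qed.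

Let finK : finite_set K. Proof. by exists k.+1. Qed.

Section Vertices.
Context (n : nat) (e : M -> 'rV[R]_n).

(** Sorting [K] by decreasing coordinate, extended by zero off [s], gives the flag. *)
Lemma bary_point_onto (s : {fset M}) z :
  (s `<=` fset_set K)%fset -> simplex e s z ->
  exists c, [/\ flags_of c, bary_point e c = z &
                (s `<` fset_set K)%fset -> wt c ord_max = 0].
Proof.
move=> sK [t [t0 t1] <-].
pose f x := if x \in s then t x else 0.
have [a [ia aK fd]] := sorted_enum f cardK.
have sa x : x \in s -> exists j, a j = x.
  move=> /(fsubsetP sK); rewrite in_fset_set// inE -aK => -[j _ <-].
  by exists j.
have wf : is_weight (f \o a).
  split=> [j|]; first by rewrite /= /f; case: ifP.
  by rewrite -t1 (sum_subrange t ia sa).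
have [u wu uf] := vertex_weight_surj wf fd.
pose c : weighted_flag := fun j => (a j, u j).
have cK : flags_of c.
  by split => //; apply: config_eq; rewrite /face initial_last.
exists c; split => //.
  rewrite bary_pointE (sum_subrange (fun x => t x *: e x) ia sa).
  apply: eq_bigr => l _; rewrite [vertex_weight _ _]uf /= /f /vert /=.
  by case: ifP; rewrite ?scale0r.
(* A vertex outside [s] has coordinate zero, so the smallest coordinate, the top weight over [k.+1],
   vanishes. *)
rewrite fproperE => /andP[_ /fsubsetPn[x]]; rewrite in_fset_set// inE -aK.
move=> [l _ <-] als; have := fd l ord_max (leq_ord l).
rewrite /f (negbTE als) -/(f _) -[f _]/((f \o a) ord_max) -uf.
rewrite /= vertex_weight_last pmulr_lle0 ?invr_gt0// => ul.
by apply/eqP; rewrite eq_le ul wu.1.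
Qed.

Lemma simplex_flags : simplex e (fset_set K) = bary_point e @` flags_of.
Proof.
apply/seteqP; split=> [z zK|_ [c cK <-]].
  by have [c [cK cz _]] := bary_point_onto (fsubset_refl _) zK; exists c.
rewrite bary_pointE; apply: simplex_family.
  by apply: vertex_weight_is_weight; exact: cK.1.
by move=> l _; rewrite in_fset_set// inE; exact: mem_vert.
Qed.

Lemma simplex_boundary_flags :
  simplex_boundary e (fset_set K) = bary_point e @` boundary_flags_of.
Proof.
apply/seteqP; split=> [z [s /= sK zs]|_ [c [cK /= c0] <-]].
  have [c [cK cz c0]] := bary_point_onto (fproper_sub sK) zs.
  by exists c => //; split => //; exact: c0.
(* The last vertex appears only in the top face, whose weight is zero. *)
exists (fset_set K `\ vert c ord_max)%fset => /=.
  by apply: fproperD1; rewrite in_fset_set// inE; exact: mem_vert.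
rewrite bary_pointE; apply: simplex_family.
  by apply: vertex_weight_is_weight; exact: cK.1.
move=> l cl; rewrite !inE in_fset_set// (mem_set (mem_vert l cK)) andbT.
apply: contraNneq cl => /(flags_of_inj cK) ->.
by rewrite vertex_weight_last c0 mul0r.
Qed.

End Vertices.

Section Faces.
Context (n : nat) (e : config M -> 'rV[R]_n).
Context (Y : nat -> set (config M)) (N' : nat).
Hypothesis kN' : (k < N')%N.
Hypothesis subK : forall L, carrier L `<=` K -> upto Y N' L.

Lemma flag_point_onto (s : {fset config M}) z : coherent Y N' s ->
  (forall L, L \in s -> carrier L `<=` K) -> simplex e s z ->
  exists c, [/\ flags_of c, flag_point e c = z &
                forall j, wt c j != 0 -> face c j \in s].
Proof.
move=> [_ ch] sK zs; have [a [ia aK sa]] := chain_enum cardK sK ch.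
have [u [wu us ->]] := simplex_coords (initial_inj ia) sa zs.
exists (fun j => (a j, u j)); split => //.
by split => //; apply: config_eq; rewrite /face initial_last.
Qed.

Lemma flag_point_tLambda c (j : 'I_k.+1) : flags_of c ->
  (forall i : 'I_k.+1, (j < i)%N -> wt c i = 0) ->
  tLambda e Y N' (face c j) (flag_point e c).
Proof.
(* Faces beyond [j] have weight zero; replacing them by face [j] leaves a chain with that face as
   principal vertex. *)
move=> cK c0; pose v (i : 'I_k.+1) := face c (if (i <= j)%N then i else j).
exists (range_fset v).
  split; first split.
  - by apply: vertices_in_range_fset => // i; apply: subK; exact: face_sub.
  - move=> _ _ /imfsetP[/= i _ ->] /imfsetP[/= i' _ ->]; rewrite /v.
    set x := if _ then _ else _; set y := if _ then _ else _.
    have [xy|yx] := leqP x y; first by left; exact: initial_sub.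
    by right; apply: initial_sub; exact: ltnW.
  - split.
      by apply/imfsetP; exists j => //; rewrite /v leqnn.
    move=> _ /imfsetP[/= i _ ->]; apply: initial_sub.
    by case: ifP.
apply: simplex_family; first exact: cK.1.
move=> i ci; apply/imfsetP; exists i => //; rewrite /v.
by case: leqP => // /c0 ci0; rewrite ci0 eqxx in ci.
Qed.

Lemma tLambda_flags : tLambda e Y N' K = flag_point e @` flags_of.
Proof.
apply/seteqP; split=> [z [s [cs [_ sK]] zs]|_ [c cK <-]].
  by have [c [cK cz _]] := flag_point_onto cs sK zs; exists c.
have := @flag_point_tLambda c ord_max cK; rewrite cK.2; apply => i.
by rewrite ltnNge leq_ord.
Qed.

Lemma boundary_tLambda_flags :
  \bigcup_(L in [set L | carrier L `<` K]) tLambda e Y N' L =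
  flag_point e @` boundary_flags_of.
Proof.
apply/seteqP; split=> [z [L [LK nLK] [s [cs [Ls sL]] zs]]|_ [c [cK /= c0] <-]].
  have sK L' : L' \in s -> carrier L' `<=` K.
    by move=> /sL; move/subset_trans; apply.
  have [c [cK cz cs']] := flag_point_onto cs sK zs.
  exists c => //; split => //=; apply/eqP; apply: contraT => /cs'.
  by rewrite cK.2 => /sL KL; case: nLK.
(* For a single point the top weight is the only one and cannot vanish. Otherwise the face omitting
   the last vertex is the witness. *)
have [k0|k0] := posnP k.
  have := cK.1.2; rewrite (bigD1 ord_max)//= c0 big1 ?addr0; last first.
    move=> i; rewrite -(inj_eq val_inj)/= => ik.
    case/negP: ik; rewrite eqn_leq leq_ord /=.
    by apply: leq_trans (leq0n i); rewrite k0.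
  by move/eqP; rewrite eq_sym oner_eq0.
have kk : (k.-1 < k.+1)%N by rewrite ltnS leq_pred.
exists (face c (Ordinal kk)).
  split; first exact: face_sub.
  rewrite -{1}cK.2 => /(leq_initial (flags_of_inj cK)) /=.
  by rewrite leqNgt prednK// leqnn.
apply: flag_point_tLambda => // i /= ki.
rewrite (_ : i = ord_max)//; apply/val_inj/eqP => /=.
by rewrite eqn_leq leq_ord; exact: leq_trans (leqSpred k) ki.
Qed.

End Faces.

End Simplices.

(** * From flags to homeomorphisms *)

Section Homeomorphisms.
Context (R : realType) (M : metricType R) (k n n' m : nat) (Z : set (config M)).
Context (e : config M -> 'rV[R]_n) (e' : M -> 'rV[R]_n').
Local Notation weighted_flag := {ptws 'I_k.+1 -> (M * R)%type}.
Hypothesis compM : compact [set: M].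
Hypothesis closedZ : closed Z.
Hypothesis km : (k < m)%N.
Hypothesis ge : generic_embedding m Z e.
Hypothesis ge' : generic_embedding k.+1 [set: M] e'.
Implicit Types (c : weighted_flag) (C D : set weighted_flag) (K : config M).

Lemma same_image c c' : flags Z c -> flags Z c' ->
  injective (vert c) -> injective (vert c') ->
  face c ord_max = face c' ord_max ->
  flag_point e c = flag_point e c' <-> bary_point e' c = bary_point e' c'.
Proof.
move=> Zc Zc' ic ic' ff; split=> [|cc'].
  move/(flag_point_same_faces km ge.2 Zc Zc' ic ic').
  exact: same_faces_bary_point.
apply: same_faces_flag_point.
exact: (bary_point_same_faces ge'.2 Zc.1 Zc'.1 ic ic' ff cc').
Qed.

Lemma homeo_on_flags C D (F : 'rV[R]_n -> 'rV[R]_n') :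
  compact C -> C `<=` flags Z -> D `<=` C ->
  (forall c c', D c -> C c' ->
     flag_point e c = flag_point e c' <-> bary_point e' c = bary_point e' c') ->
  (forall c, D c -> F (flag_point e c) = bary_point e' c) ->
  homeo_on (flag_point e @` D) (bary_point e' @` D) F.
Proof.
move=> cC CZ DC id FD; apply: (@homeo_on_param _ _ _ C).
- exact: norm_hausdorff.
- exact: norm_hausdorff.
- exact: cC.
- exact: DC.
- by apply: continuous_subspaceW CZ _; apply: flag_point_continuous; exact: ge.1.
- apply: continuous_subspaceT; apply: bary_point_continuous.
  by apply/continuous_subspace_setT; exact: ge'.1.
- exact: id.
- exact: FD.
Qed.

Section Over_configuration.
Variable K : config M.
Hypothesis cardK : (carrier K #= `I_k.+1)%card.
Hypothesis subK : forall L, carrier L `<=` K -> Z L.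

Lemma flags_of_sub : flags_of (k := k) K `<=` flags Z.
Proof. by move=> c cK; split=> [|j]; [exact: cK.1|apply: subK; exact: face_sub]. Qed.

Lemma homeo_on_simplex : exists H : 'rV[R]_n -> 'rV[R]_n',
  [/\ forall c, flags_of K c -> H (flag_point e c) = bary_point e' c,
      homeo_on (flag_point e @` flags_of (k := k) K)
               (bary_point e' @` flags_of (k := k) K) H &
      homeo_on (flag_point e @` boundary_flags_of (k := k) K)
               (bary_point e' @` boundary_flags_of (k := k) K) H].
Proof.
have id c c' : flags_of K c -> flags_of K c' ->
    flag_point e c = flag_point e c' <-> bary_point e' c = bary_point e' c'.
  move=> cK c'K; apply: same_image; try exact: flags_of_sub.
  - exact: (flags_of_inj cardK).
  - exact: (flags_of_inj cardK).
  - by rewrite cK.2 c'K.2.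
have [|H HP] := factor_through (0 : 'rV[R]_n') (D := flags_of (k := k) K)
    (p := flag_point e) (q := bary_point e').
  by move=> c c' cK c'K; exact: (id _ _ cK c'K).1.
(* The flags over [K] are the fibre over a closed point of the continuous top face map. *)
have cK : compact (flags_of (k := k) K).
  have -> : flags_of (k := k) K =
      flags Z `&` (fun c => face c ord_max) @^-1` [set K].
    apply/seteqP; split=> [c cK|c [[wc _] cK]] //; split; last exact: cK.2.
    exact: flags_of_sub.
  apply: compact_closedI; first exact: flags_compact.
  move/continuous_closedP: (@face_continuous R M k ord_max); apply.
  by apply: accessible_closed_set1; apply/hausdorff_accessible/metric_hausdorff.
exists H; split => //.
- apply: (homeo_on_flags cK) => //; exact: flags_of_sub.
- apply: (homeo_on_flags cK) => //.
  + exact: flags_of_sub.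
  + by move=> c [].
  + by move=> c c' [cK' _]; exact: id.
  + by move=> c [cK' _]; exact: HP.
Qed.

End Over_configuration.

(** The compact parameter space is all of [flags Z], degenerate flags included. The two range lemmas
    show that none of these shares a point with an open flag on either side. *)
Lemma homeo_on_open_flags (S : set (config M)) :
  (forall K, S K -> (carrier K #= `I_k.+1)%card) ->
  (forall K L, S K -> carrier L `<=` K -> Z L) ->
  exists F : 'rV[R]_n -> 'rV[R]_n',
    (forall c, open_flags S c -> F (flag_point e c) = bary_point e' c) /\
    homeo_on (flag_point e @` open_flags (k := k) S)
             (bary_point e' @` open_flags (k := k) S) F.
Proof.
move=> cardS subS; set D := open_flags S.
have DK c : D c -> flags_of (face c ord_max) c by case.
have DZ : D `<=` flags Z.
  by move=> c cD; case: (cD) => _ cS _; apply: flags_of_sub (DK c cD) => L /(subS _ _ cS).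
have Dinj c : D c -> injective (vert c).
  by move=> cD; apply: flags_of_inj (DK c cD); apply: cardS; case: cD.
have id c c' : D c -> flags Z c' ->
    flag_point e c = flag_point e c' <-> bary_point e' c = bary_point e' c'.
  move=> cD Zc'; have Zc := DZ _ cD; have ic := Dinj _ cD; case: (cD) => wc _ cl.
  split=> cc'.
    have [ic' ff] := flag_point_range km ge.2 Zc Zc' ic cl cc'.
    by apply/same_image => //.
  have [ic' ff] := bary_point_range ge'.2 wc Zc'.1 ic cl cc'.
  by apply/same_image => //.
have [|F FP] := factor_through (0 : 'rV[R]_n') (D := D)
    (p := flag_point e) (q := bary_point e').
  by move=> c c' cD /DZ Zc'; exact: (id _ _ cD Zc').1.
exists F; split => //; apply: (homeo_on_flags (C := flags Z)) => //.
exact: flags_compact.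
Qed.

End Homeomorphisms.

(** * The strata of the filtration *)

Section Finite_stratum.
Context (R : realType) (M : metricType R) (X Y : nat -> set (config M)).
Context (N N' : nat) (alpha : nat -> nat) (i : nat).
Hypothesis X7 : cond7 X N.
Hypothesis Xgeom : forall K, closures X N K -> exists G, is_geom X N K G.
Hypothesis Y2 : cond2 Y N'.
Hypothesis Y4 : cond4 Y N'.
Hypothesis alpha0 : alpha 0%N = 0%N.
Hypothesis alpha_range : forall i, (1 <= i <= N)%N -> (1 <= alpha i <= N')%N.
Hypothesis alpha_mono : forall i j, (1 <= i)%N -> (i < j)%N -> (j <= N)%N ->
  (alpha i < alpha j)%N.
Hypothesis YX : forall i, (1 <= i <= N)%N -> Y (alpha i) = X i.
Hypothesis uptoY : upto Y N' = closures X N.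
Hypothesis geomX : forall i j K G, (1 <= i <= N)%N ->
  (alpha i.-1 < j <= alpha i)%N -> Y j K -> is_geom X N K G -> X i G.
Hypothesis iN : (1 <= i <= N)%N.
Hypothesis finX : forall K, X i K -> finite_set (carrier K).
Implicit Types K L G : config M.

Lemma upto_sub (W : nat -> set (config M)) m m' : (m <= m')%N ->
  upto W m `<=` upto W m'.
Proof.
move=> mm K [j /= /andP[j1 jm] WK]; exists j => //=.
by rewrite j1 (leq_trans jm mm).
Qed.

Lemma leq_alpha l l' : (l <= l')%N -> (l' <= N)%N -> (alpha l <= alpha l')%N.
Proof.
rewrite leq_eqVlt => /predU1P[->//|ll] lN.
have [->|l0] := posnP l; first by rewrite alpha0.
exact/ltnW/alpha_mono.
Qed.

Lemma upto_alpha l K : (l <= N)%N -> upto X l K -> upto Y (alpha l) K.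
Proof.
move=> lN [j /= /andP[j1 jl] XK]; have jN : (1 <= j <= N)%N by rewrite j1 (leq_trans jl).
exists (alpha j) => /=; last by rewrite YX.
by rewrite (andP (alpha_range jN)).1 leq_alpha.
Qed.

Lemma alphaN' : (alpha i <= N')%N.
Proof. by case/andP: (alpha_range iN). Qed.

Lemma pred_alpha : (alpha i.-1 <= (alpha i).-1)%N.
Proof.
have /andP[i0 i1] := iN; have /andP[a0 _] := alpha_range iN.
have [i10|i10] := posnP i.-1; first by rewrite i10 alpha0.
by rewrite -ltnS (prednK a0) alpha_mono// prednK.
Qed.

Lemma stratum_indexY j K : (1 <= j <= N')%N -> X i K -> Y j K -> j = alpha i.
Proof.
move=> jN XK YK; apply: contrapT => ja.
have : (Y j `&` Y (alpha i)) K by split; rewrite ?YX.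
by rewrite (Y4 jN (alpha_range iN) ja).
Qed.

Lemma proper_face K L : X i K -> carrier L `<` K -> upto X i.-1 L.
Proof. by move=> XK; apply: X7 iN XK (finX XK). Qed.

Lemma subface K L : X i K -> carrier L `<=` K -> L = K \/ upto X i.-1 L.
Proof.
move=> XK LK; have [KL|KL] := pselect (carrier K `<=` L).
  by left; apply/config_eq/seteqP.
by right; apply: proper_face XK _.
Qed.

Lemma subface_upto K L : X i K -> carrier L `<=` K -> upto Y N' L.
Proof.
move=> XK /(subface XK)[->|XL].
  apply: (upto_sub alphaN'); exists (alpha i); rewrite ?YX//=.
  by rewrite (andP (alpha_range iN)).1 leqnn.
apply: (upto_sub alphaN'); apply: (upto_sub (leq_pred (alpha i))).
apply: (upto_sub pred_alpha); apply: upto_alpha => //.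
by rewrite (leq_trans (leq_pred _))//; case/andP: iN.
Qed.


(** A proper subset of [K] is itself an element of some [X j], so minimality of the geometrisation
    would put [K] inside it. *)
Lemma is_geom_subface K L : X i K -> carrier L `<=` K -> is_geom X N L K -> L = K.
Proof.
move=> XK LK [_ _ min]; have [//|[j /= jr XL]] := subface XK LK.
apply/config_eq/seteqP; split => //; apply: min => //.
by exists j => //=; move: jr iN; clear; lia.
Qed.

(** The geometrisation lies in [X i], hence is finite, and [K] is contained in it; the two therefore
    coincide. *)
Lemma middle_stratum j K : (alpha i.-1 < j <= alpha i)%N -> Y j K -> X i K.
Proof.
move=> ja YK; have YN : upto Y N' K.
  exists j => //=; rewrite (leq_ltn_trans (leq0n _) (andP ja).1).
  by rewrite (leq_trans (andP ja).2 alphaN').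
have [|G gG] := Xgeom (K := K); first by rewrite -uptoY.
have XG := geomX iN ja YK gG; case: (gG) => _ KG _.
by rewrite (is_geom_subface XG KG gG).
Qed.

Lemma lower_face_alpha K L : X i K -> carrier L `<=` K ->
  upto Y (alpha i).-1 L <-> upto X i.-1 L.
Proof.
move=> XK LK; split=> [[j /= jr YL]|XL]; last first.
  apply: (upto_sub pred_alpha); apply: upto_alpha => //.
  by move: iN; lia.
have [LK'|//] := subface XK LK; rewrite LK' in YL.
have jN : (1 <= j <= N')%N by move: jr (alpha_range iN); lia.
by move: jr; rewrite (stratum_indexY jN XK YL); lia.
Qed.

(** Equality would contradict the disjointness of the [Y j], and proper inclusion their
    monotonicity. *)
Lemma not_sub_lower K L j : (1 <= j)%N -> (j < alpha i)%N -> X i K -> Y j L ->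
  ~ carrier K `<=` L.
Proof.
move=> j1 ja XK YL KL; have jN : (1 <= j <= N')%N by move: (alpha_range iN); lia.
have [LK|LK] := pselect (carrier L `<=` K).
  have eKL : K = L by apply/config_eq/seteqP.
  have := stratum_indexY jN XK; rewrite eKL => /(_ YL); lia.
have := Y2 (alpha_range iN) jN _ YL (conj KL LK); rewrite YX// => /(_ XK); lia.
Qed.

Section Joins.
Context (n : nat) (e : config M -> 'rV[R]_n).

Lemma tLambda_Lambda K : X i K -> tLambda e Y N' K = Lambda e X N Y N' K.
Proof.
move=> XK; apply/seteqP; split=> z [s /=].
  move=> [cs ps] zs; exists s => //; split => // L Ls LK gL.
  by apply: LK; apply: is_geom_subface gL => //; exact: ps.2.
by move=> [cs ps _] zs; exists s.
Qed.

Lemma tdLambda_dLambda K : X i K ->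
  tdLambda e Y N' (alpha i) K = dLambda e X Y N' i K.
Proof.
move=> XK; apply/seteqP; split=> z [L /= [uL LK] zL]; exists L => //; split => //.
  exact/(lower_face_alpha XK LK).
exact/(lower_face_alpha XK LK).
Qed.

Lemma dLambda_boundary K : X i K -> dLambda e X Y N' i K =
  \bigcup_(L in [set L | carrier L `<` K]) tLambda e Y N' L.
Proof.
move=> XK; apply/seteqP; split=> z [L /=].
  move=> [uL LK] zL; exists L => //; split=> // KL.
  have [j /= jr YL] := (lower_face_alpha XK LK).2 uL.
  by apply: not_sub_lower XK YL KL; lia.
move=> LK zL; exists L => //; split; last exact: LK.1.
exact: proper_face LK.
Qed.

Context (k : nat).
Hypothesis cardX : forall K, X i K -> (carrier K #= `I_k.+1)%card.
Local Notation weighted_flag := {ptws 'I_k.+1 -> (M * R)%type}.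

(** The [k.+1] faces of a full flag of [K] lie in distinct [Y j] by monotonicity. This brings flags
    within reach of [N']-genericity. *)
Lemma leq_join K : X i K -> (k < N')%N.
Proof.
move=> XK; have [a [ia aK _]] := sorted_enum (fun=> 0 : R) (cardX XK).
have subK j : carrier (initial a j) `<=` K.
  by rewrite -aK -initial_last; apply: initial_sub; exact: leq_ord.
have /choice[g gP] : forall j : 'I_k.+1, exists g : 'I_N', Y g.+1 (initial a j).
  move=> j; have [l /= lr Yl] := subface_upto XK (@subK j).
  have lN : (l.-1 < N')%N by lia.
  by exists (Ordinal lN); rewrite /= prednK//; case/andP: lr.
have gN (g' : 'I_N') : (1 <= g'.+1 <= N')%N by rewrite ltn_ord.
have ginj : injective g.
  move=> j j' gg; apply/val_inj/eqP; apply: contraT; rewrite neq_ltn => jj'.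
  wlog {jj'} jj' : j j' gg / (j < j')%N.
    by move=> W; case/orP: jj' => jj'; [exact: (W j j')|exact: (W j' j)].
  have lt : carrier (initial a j) `<` initial a j'.
    split; first by apply: initial_sub; exact: ltnW.
    by move=> /(leq_initial ia); rewrite leqNgt jj'.
  by have := Y2 (gN _) (gN _) (gP j) (gP j') lt; rewrite gg ltnn.
by have := leq_card g ginj; rewrite !card_ord.
Qed.

Lemma Lambda_flags K : X i K ->
  Lambda e X N Y N' K = flag_point e @` flags_of (k := k) K.
Proof.
move=> XK; rewrite -tLambda_Lambda//.
apply: (tLambda_flags (cardX XK) e (leq_join XK)).
by move=> L; exact: subface_upto.
Qed.

Lemma dLambda_flags K : X i K ->
  dLambda e X Y N' i K = flag_point e @` boundary_flags_of (k := k) K.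
Proof.
move=> XK; rewrite dLambda_boundary//.
apply: (boundary_tLambda_flags (cardX XK) e (leq_join XK)).
by move=> L; exact: subface_upto.
Qed.

Hypothesis ge : generic N' (upto Y N') e.

Lemma open_flags_of (c : weighted_flag) :
  open_flags (X i) c -> flags_of (face c ord_max) c.
Proof. by case. Qed.

Lemma Phi_flags : Phi e Y N' (alpha i) `\` Phi e Y N' (alpha i.-1) =
  flag_point e @` open_flags (k := k) (X i).
Proof.
have /andP[a1 _] := alpha_range iN.
apply/seteqP; split=> [z [[K [j /= jr YK] zK] nz]|_ [c cD <-]].
  have ja : (alpha i.-1 < j <= alpha i)%N.
    rewrite (andP jr).2 andbT ltnNge; apply/negP => ja.
    by apply: nz; exists K => //; exists j => //=; rewrite (andP jr).1.
  have XK := middle_stratum ja YK.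
  move: (zK); rewrite tLambda_Lambda// Lambda_flags// => -[c cK cz].
  exists c => //; split; [exact: cK.1|by rewrite cK.2|].
  (* A vanishing top weight would put [z] in a cone over an earlier configuration, hence in the
     smaller [Phi]. *)
  apply/eqP => c0; have : dLambda e X Y N' i K z.
    by rewrite dLambda_flags//; exists c.
  move=> [L [uL LK] zL]; apply: nz; exists L => //.
  by apply: upto_alpha => //; move: iN; lia.
have cK := open_flags_of cD; case: (cD) => wc XK cl.
split.
  exists (face c ord_max); first by exists (alpha i); rewrite ?YX//= a1 leqnn.
  by rewrite tLambda_Lambda// Lambda_flags//; exists c.
(* If the point lay in a cone over a lower [L], genericity would make its top face a vertex of a
   coherent simplex below [L], hence a subset of [L]. *)
move=> [L [j /= jr YL] [s [cs [Ls sL]] zs]].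
apply: (@not_sub_lower (face c ord_max) L j) => //; first by case/andP: jr.
  by move: jr pred_alpha; lia.
apply: sL; apply: (mem_simplex_mass (leq_join XK) ge _ wc cs.1 zs).
  by move=> l; apply: subface_upto XK _; exact: face_sub cK.
by rewrite mass_inj//; apply: initial_inj; exact: flags_of_inj (cardX XK) _ cK.
Qed.

End Joins.

End Finite_stratum.

(** * Barycentres and the final assembly *)

Lemma homeo_on_set0 (S T : topologicalType) (f : S -> T) : homeo_on set0 set0 f.
Proof.
split; first exact: continuous_subspace0.
  by split=> // x; rewrite inE.
by move=> U _; exists setT; [exact: openT|rewrite !set0I image_set0].
Qed.

Section Barycentre.
Context (R : realType) (M : metricType R) (k n n' : nat).
Context (e : config M -> 'rV[R]_n) (e' : M -> 'rV[R]_n').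

Lemma top_flag (K : config M) : (carrier K #= `I_k.+1)%card ->
  exists c : {ptws 'I_k.+1 -> (M * R)%type}, [/\ flags_of K c, wt c ord_max = 1,
    flag_point e c = e K & bary_point e' c = barycentre e' (fset_set K)].
Proof.
move=> cK; have [a [ia aK _]] := sorted_enum (fun=> 0 : R) cK.
pose c : {ptws 'I_k.+1 -> (M * R)%type} := fun j => (a j, (j == ord_max)%:R).
have sumc (V : lmodType R) (g : 'I_k.+1 -> V) : \sum_j wt c j *: g j = g ord_max.
  rewrite (bigD1 ord_max)//= /wt /= eqxx scale1r big1 ?addr0// => j /negbTE jm.
  by rewrite /wt /= jm scale0r.
have fc : face c ord_max = K by apply: config_eq; rewrite /face initial_last.
exists c; split.
- split=> //; split=> [j|]; first exact: ler0n.
  rewrite -[RHS](sumc R^o (fun=> 1)); apply: eq_bigr => j _.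
  by rewrite /GRing.scale /= mulr1.
- by rewrite /wt /= eqxx.
- by rewrite /flag_point sumc fc.
- rewrite /bary_point sumc /barycentre (card_fset_set cK); congr (_ *: _).
  by rewrite (sum_initial e' ord_max ia) -/(face c ord_max) fc.
Qed.

End Barycentre.

Theorem theorem6 (R : realType) (k : numFieldType) (V : vectType k)
    (M : metricType R) (E : vector_bundle k M) (ev : const_rank_map V E)
    (X Y : nat -> set (config M)) (N N' : nat) (alpha : nat -> nat) :
  real_or_complex R k ->
  finite_CW [set: M] ->
  cond1 ev X N -> cond2 X N -> cond3 ev X N -> cond4 X N ->
  cond5_minus ev X N ->
  cond1 ev Y N' -> cond2 Y N' -> cond3 ev Y N' -> cond4 Y N' ->
  cond5_plus Y N' ->
  alpha 0%N = 0%N ->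
  (forall i, (1 <= i <= N)%N -> (1 <= alpha i <= N')%N) ->
  (forall i j, (1 <= i)%N -> (i < j)%N -> (j <= N)%N ->
    (alpha i < alpha j)%N) ->
  (forall i, (1 <= i <= N)%N -> Y (alpha i) = X i) ->
  upto Y N' = closures X N ->
  (forall i j K G, (1 <= i <= N)%N -> (alpha i.-1 < j <= alpha i)%N ->
    Y j K -> is_geom X N K G -> X i G) ->
  finite_CW (upto Y N') ->
  cond5 ev X N -> cond6 X N -> cond7 X N ->
  forall i k0 : nat, (1 <= i <= N)%N ->
  (forall K, X i K -> (carrier K #= `I_k0)%card) ->
  forall (n n' : nat) (e : config M -> 'rV[R]_n) (e' : M -> 'rV[R]_n'),
  generic_embedding N' (upto Y N') e ->
  generic_embedding k0 [set: M] e' ->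
  let tL := tLambda e Y N' in
  let tdL := tdLambda e Y N' (alpha i) in
  let L := Lambda e X N Y N' in
  let dL := dLambda e X Y N' i in
  let D := Phi e Y N' (alpha i) `\` Phi e Y N' (alpha i.-1) in
  (forall K, X i K -> tL K = L K /\ tdL K = dL K) /\
  exists F : 'rV[R]_n -> 'rV[R]_n',
    [/\ {within D, continuous F},
        F @` D `<=` self_join k0 [set: M] e',
        forall K, X i K ->
          [/\ (L K `\` dL K) (e K),
              L K `\` dL K `<=` D &
              F (e K) = barycentre e' (fset_set K)],
        homeo_on D (F @` D) F &
        forall K, X i K -> exists H : 'rV[R]_n -> 'rV[R]_n',
          [/\ homeo_on (L K) (simplex e' (fset_set K)) H,
              forall z, (L K `\` dL K) z -> H z = F z,
              dL K `<=` L K &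
              homeo_on (dL K) (simplex_boundary e' (fset_set K)) H]].
Proof.
move=> _ /finite_CW_compact compM _ _ _ X4 _ _ Y2 _ Y4 _ a0 ar am YX uY gX
  /finite_CW_compact compY [Xg _] _ X7 i k0 iN cardX n n' e e' ge ge'
  tL tdL L dL D.
have closedY : closed (upto Y N').
  by apply: compact_closed => //; exact: metric_hausdorff.
have geom K : closures X N K -> exists G, is_geom X N K G.
  by move=> /Xg[G gG _]; exists G.
have finX K : X i K -> finite_set (carrier K) by move=> /cardX ?; exists k0.
split=> [K XK|].
  split; first exact: (tLambda_Lambda Y N' X7 iN finX e XK).
  exact: (tdLambda_dLambda X7 Y4 a0 ar am YX iN finX e XK).
(* A configuration in [X i] is wanted to bound [k0] by [N'] and to exclude [k0 = 0]. If there is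
   none, the stratum is empty and a constant map will do. *)
have [X0|/existsNP[K0 /contrapT XK0]] := pselect (forall K, ~ X i K).
  have D0 : D = set0.
    rewrite -subset0 => z [[K [j /= jr YK] zK] nz]; apply: nz.
    exists K => //; exists j => //=; rewrite (andP jr).1 leqNgt.
    apply/negP => ja; apply: (X0 K).
    apply: (middle_stratum X7 geom ar uY gX iN finX _ YK).
    by rewrite ja (andP jr).2.
  exists (fun=> 0); rewrite D0 image_set0; split=> //.
  - exact: continuous_subspace0.
  - by move=> K /X0.
  - exact: homeo_on_set0.
  - by move=> K /X0.
case: k0 cardX ge' => [|k1] cardX ge'.
  have := cardX _ XK0; rewrite II0 card_eq0 => /eqP K00.
  by have := config_nonempty K0; rewrite K00 => -[].
have kN : (k1 < N')%N := leq_join X7 Y2 a0 ar am YX iN finX cardX XK0.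
have LE K : X i K -> L K = flag_point e @` flags_of (k := k1) K.
  exact: (Lambda_flags X7 Y2 a0 ar am YX iN finX).
have dLE K : X i K -> dL K = flag_point e @` boundary_flags_of (k := k1) K.
  exact: (dLambda_flags X7 Y2 Y4 a0 ar am YX iN finX).
have DE : D = flag_point e @` open_flags (k := k1) (X i).
  exact: (Phi_flags X7 geom Y2 Y4 a0 ar am YX uY gX iN finX cardX ge.2).
have subX K K' : X i K -> carrier K' `<=` K -> upto Y N' K'.
  exact: (subface_upto X7 a0 ar am YX iN finX).
have [F [FE Fhom]] := homeo_on_open_flags compM closedY kN ge ge' cardX subX.
rewrite -DE in Fhom.
have FD : F @` D = bary_point e' @` open_flags (k := k1) (X i).
  rewrite DE image_comp; apply/seteqP; split=> _ [c cD <-]; exists c => //=.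
    by rewrite FE.
  by rewrite FE.
have openK K z : X i K -> (L K `\` dL K) z ->
    exists c, [/\ flags_of (k := k1) K c, open_flags (X i) c & flag_point e c = z].
  move=> XK [+ nz]; rewrite LE// => -[c cK cz]; exists c; split=> //.
  split; [exact: cK.1|by rewrite cK.2|apply/eqP => c0; apply: nz].
  by rewrite dLE//; exists c.
exists F; split.
- by case: Fhom.
- rewrite FD => _ [c [wc XK cl] <-]; have cK : flags_of (face c ord_max) c by [].
  exists (range_fset (vert c)); first exact: vertices_in_range_fset.
  rewrite bary_pointE; apply: simplex_family; first exact: vertex_weight_is_weight.
  by move=> l _; exact: mem_range_fset.
- move=> K XK; have [c [cK cl ce ce']] := top_flag e e' (cardX _ XK).
  have cD : open_flags (X i) c.
    by split; [exact: cK.1|rewrite cK.2|rewrite cl oner_eq0].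
  split.
  + split; first by rewrite LE//; exists c.
    (* The flag of [e K] has top weight 1, a boundary flag has top weight 0, and the point
       determines the weights. *)
    rewrite dLE// => -[d [dK /= d0] de].
    have flK : flags_of (k := k1) K `<=` flags (upto Y N').
      by apply: flags_of_sub => K'; exact: subX.
    have ic f : flags_of (k := k1) K f -> injective (vert f).
      exact: (flags_of_inj (cardX _ XK)).
    have /(_ ord_max)[] := flag_point_same_faces kN ge.2 (flK _ cK) (flK _ dK)
      (ic _ cK) (ic _ dK) (etrans ce (esym de)).
    by rewrite cl d0 => /eqP; rewrite oner_eq0.
  + by move=> z /(openK _ _ XK)[d [_ dD <-]]; rewrite DE; exists d.
  + by rewrite -ce FE.
- by rewrite FD.
- move=> K XK; have [H [HE Hs Hb]] :=
    homeo_on_simplex compM closedY kN ge ge' (cardX _ XK) (fun K' => subX K K' XK).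
  exists H; rewrite (simplex_flags (cardX _ XK)) (simplex_boundary_flags (cardX _ XK)).
  rewrite LE// dLE//; split=> //.
  + rewrite -LE// -dLE// => z /(openK _ _ XK)[c [cK cD <-]].
    by rewrite HE// FE.
  + by move=> _ [c [cK _] <-]; exists c.
Qed.
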